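(* There exists an integer $N$ such that for every integer $n \geq N$ and every non-trivial graph property $f:\{0,1\}^{\binom{[n]}{2}} \to \{0,1\}$ on $n$ vertices, the sensitivity satisfies $s(f) \geq \lfloor \tfrac{1}{2} n \rfloor$.
   Context: Identify a string $x \in \{0,1\}^{\binom{[n]}{2}}$ (one bit $x_{\{i,j\}}$ for each unordered pair $\{i,j\}$ of distinct elements of $[n]=\{1,\dots,n\}$) with the graph on vertex set $[n]$ whose edges are the pairs $\{i,j\}$ with $x_{\{i,j\}}=1$. A function $f:\{0,1\}^{\binom{[n]}{2}} \to \{0,1\}$ is a graph property if $f(G)=f(H)$ whenever the graphs $G$ and $H$ on vertex set $[n]$ are isomorphic (equivalently, $f$ is invariant under the action of $S_n$ permuting the vertices). It is non-trivial if it is not constant. For a boolean function $f:\{0,1\}^m\to\{0,1\}$ and a point $x$, the sensitivity of $f$ at $x$ is $s(f,x)=|\{i \in [m] : f(x\oplus e_i)\neq f(x)\}|$, the number of coordinates whose flip changes the value of $f$ (for graph properties: the number of pairs $\{i,j\}$ whose addition or removal as an edge changes $f$); the sensitivity of $f$ is $s(f)=\max_x s(f,x)$. *)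

(* Defs.v *)
From mathcomp Require Import all_boot all_order all_fingroup.
Set Implicit Arguments. Unset Strict Implicit. Unset Printing Implicit Defensive.

Definition vpair (n : nat) := {e : {set 'I_n} | #|e| == 2}.

Definition graph (n : nat) := {ffun vpair n -> bool}.

Lemma card_imset_perm n (s : {perm 'I_n}) (e : {set 'I_n}) :
  #|s @: e| = #|e|.
Proof. by apply: card_imset; apply: perm_inj. Qed.

Definition pmap n (s : {perm 'I_n}) (e : vpair n) : vpair n :=
  exist _ (s @: val e) (eq_ind_r (fun k => k == 2) (valP e) (card_imset_perm s (val e))).

Definition isomorphic n (G H : graph n) : Prop :=
  exists s : {perm 'I_n}, forall e : vpair n, H (pmap s e) = G e.

Definition graph_property n (f : graph n -> bool) : Prop :=
  forall G H : graph n, isomorphic G H -> f G = f H.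

Definition nontrivial n (f : graph n -> bool) : Prop :=
  exists G H : graph n, f G != f H.

Definition flip n (x : graph n) (e : vpair n) : graph n :=
  [ffun e' => if e' == e then ~~ x e' else x e'].

Definition sens_at n (f : graph n -> bool) (x : graph n) : nat :=
  #|[set e : vpair n | f (flip x e) != f x]|.

Definition sensitivity n (f : graph n -> bool) : nat :=
  \max_(x : graph n) sens_at f x.

(* Main.v *)
Require Import Defs.
From mathcomp Require Import all_boot all_order all_fingroup.
From mathcomp Require Import zify.
Set Implicit Arguments. Unset Strict Implicit. Unset Printing Implicit Defensive.

(** Let [k = n/2], suppose every graph has fewer than [k] sensitive pairs, and
normalise [f] so that the empty graph has value 0.  If [f] is not constant there
are inclusion-minimal graphs of value 1; in such a graph [G] every edge is
sensitive, so [G] has [m < k] edges and some set [I] of isolated vertices, which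
are interchangeable: if one new edge from an isolated vertex to [x] is
sensitive, so are all of them.

If no minimal graph has a leaf, take a minimal [G] with a vertex [u] of least
degree [d >= 2] among all minimal graphs; then [|I| >= n - m].  Attach every
vertex of [I] to a set of at most [d - 1] vertices of [G].  By the choice of [d]
this never turns [G - e] into a graph of value 1, and an exchange argument shows
that it never turns [G] into a graph of value 0.  Hence if [v] is a neighbour of
[u] and every vertex of [I] is joined to all other neighbours of [u], then in
[G - uv] the vertex [u] has more than [k] twins, each of which can be joined to
[v].

A leafy minimal graph has no isolated edge: otherwise any two isolated vertices
of [G] form a sensitive pair of [G - uv], [I] is tiny, [G] is close to a perfect
matching, and joining [u] to many matching edges [xy] of [G - uv] makes all the
[y] sensitive to every vertex of [I].  Then all neighbours of leaves have degree
at least 3.  Choose a leafy minimal [G] with as few non-leaf edges as possible,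
and a set [X] of vertices carrying at least two leaves each, minimal with at
least [k - |I| - 1] leaves in total.  For a suitable further leaf [u] at [v],
remove [uv] and give each [x] in [X] one pendant vertex from [I]: now [v] can be
joined to [u], to any vertex of [I], and to any leaf at [X], which are at least
[k] sensitive pairs. *)

Local Notation "x -- y" := [set x; y] (at level 45).

Lemma setD1_notin (T : finType) (A : {set T}) x : x \notin A -> A :\ x = A.
Proof. by move=> xA; apply/setDidPl; rewrite disjoint_sym disjoints1. Qed.

Section Graphs.

Variable T : finType.
Implicit Types (G H K Z : {set {set T}}) (a b u v w x y z : T) (e : {set T}).

Definition nb G x := [set y | (y != x) && (x -- y \in G)].

Definition supp G := [set x | nb G x != set0].

Definition leaf G := [set x | #|nb G x| == 1].

Definition leaves G x := nb G x :&: leaf G.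

Lemma edgeC x y : x -- y = y -- x.
Proof. exact: setUC. Qed.

Lemma edge_eq a b x y :
  (a -- b == x -- y) = (a == x) && (b == y) || (a == y) && (b == x).
Proof.
apply/eqP/orP => [E|[]/andP[/eqP-> /eqP->] //]; last by rewrite edgeC.
have := set21 a b; have := set22 a b; have := set21 x y; have := set22 x y.
rewrite {1 2}E -{1 2}E !inE ![y == _]eq_sym ![x == _]eq_sym.
do 4![case/orP=> /eqP ?]; subst; rewrite ?eqxx ?orbT /=; auto.
Qed.

Lemma card_edge x y : (#|x -- y| == 2) = (x != y).
Proof. by rewrite cards2; case: (x != y). Qed.

Lemma in_nb G x y : (y \in nb G x) = (y != x) && (x -- y \in G).
Proof. by rewrite inE. Qed.

Lemma nbC G x y : (y \in nb G x) = (x \in nb G y).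
Proof. by rewrite !in_nb eq_sym edgeC. Qed.

Lemma notin_supp G x y : x \notin supp G -> y != x -> (x -- y \in G) = false.
Proof.
rewrite inE negbK => /eqP E yx; apply/negbTE/negP=> xyG.
by have := in_set0 y; rewrite -E in_nb yx xyG.
Qed.

Lemma in_supp G x y : x != y -> x -- y \in G -> x \in supp G.
Proof.
by move=> xy xyG; rewrite inE; apply/set0Pn; exists y; rewrite in_nb eq_sym xy.
Qed.

Lemma leaf_nb G u : u \in leaf G -> exists v, nb G u = [set v].
Proof. by rewrite inE => /cards1P. Qed.

Lemma leaf_nbE G u v : u \in leaf G -> v \in nb G u -> nb G u = [set v].
Proof. by case/leaf_nb=> v' ->; rewrite in_set1 => /eqP->. Qed.

Lemma leaf_supp G : leaf G \subset supp G.
Proof. by apply/subsetP=> u; rewrite !inE -card_gt0 => /eqP->. Qed.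

Lemma nb_sub G K x : K \subset G -> nb K x \subset nb G x.
Proof.
move=> KG; apply/subsetP=> y; rewrite !in_nb => /andP[-> /(subsetP KG)->] //.
Qed.

Lemma supp_sub G K : K \subset G -> supp K \subset supp G.
Proof.
move=> KG; apply/subsetP=> x; rewrite !inE => /set0Pn[y yK].
by apply/set0Pn; exists y; apply: subsetP yK; apply: nb_sub.
Qed.

Lemma card_nb G x :
  (forall e, e \in G -> #|e| = 2) -> #|nb G x| = #|[set e in G | x \in e]|.
Proof.
move=> G2; rewrite -(@card_in_imset _ _ (fun y => x -- y)); last first.
  move=> y z _ _ /eqP; rewrite edge_eq eqxx /=.
  by case/orP=> [/eqP//|/andP[/eqP-> /eqP->]].
apply: eq_card => e; rewrite inE; apply/imsetP/andP => [[y]|[eG xe]].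
  by rewrite in_nb => /andP[yx xyG] ->; rewrite set21.
have /eqP/cards2P[a [b [ab Ee]]] := G2 e eG.
move: xe; rewrite Ee !inE => /orP[/eqP E|/eqP E]; subst x.
  by exists b => //; rewrite in_nb eq_sym ab -Ee.
by exists a; rewrite ?in_nb ?ab 1?edgeC // -Ee.
Qed.

Lemma handshake G :
  (forall e, e \in G -> #|e| = 2) -> \sum_(x in supp G) #|nb G x| = 2 * #|G|.
Proof.
move=> G2; transitivity (\sum_x #|nb G x|).
  rewrite [RHS](bigID (mem (supp G))) /= [X in _ + X]big1 ?addn0 //.
  by move=> x; rewrite inE negbK => /eqP->; rewrite cards0.
under eq_bigr do rewrite card_nb // -sum1dep_card.
rewrite (exchange_big_dep (fun e => e \in G)) /=; last by move=> i j _ /andP[].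
transitivity (\sum_(e in G) 2); last by rewrite sum_nat_const mulnC.
apply: eq_bigr => e eG; rewrite -(G2 e eG) -sum1_card.
by apply: eq_bigl => x; rewrite eG.
Qed.

Lemma sum_leaves G : \sum_(x in supp G) #|leaves G x| = #|leaf G|.
Proof.
transitivity (\sum_x #|leaves G x|).
  rewrite [RHS](bigID (mem (supp G))) /= [X in _ + X]big1 ?addn0 //.
  by move=> x; rewrite inE negbK /leaves => /eqP->; rewrite set0I cards0.
under eq_bigr do rewrite -sum1_card.
rewrite (exchange_big_dep (fun u => u \in leaf G)) /=; last first.
  by move=> x u _; rewrite inE => /andP[].
rewrite -sum1_card; apply: eq_bigr => u uG.
have [v Ev] := leaf_nb uG.
rewrite (bigD1 v) /=; last by rewrite inE uG nbC Ev set11.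
rewrite big1 // => x; rewrite inE uG andbT nbC Ev inE.
by case/andP=> ->.
Qed.

Lemma leaf_del_supp G u v : nb G u = [set v] -> u \notin supp (G :\ (u -- v)).
Proof.
move=> Nu; rewrite inE negbK -subset0; apply/subsetP=> y.
rewrite in_nb in_setD1 => /and3P[yu uvy uyG].
have : y \in nb G u by rewrite in_nb yu.
by rewrite Nu in_set1 => /eqP E; rewrite E eqxx in uvy.
Qed.

Lemma sum_mem_supp G (C : {set T}) : C \subset supp G ->
  \sum_(x in supp G) (x \in C) = #|C|.
Proof.
move=> CG; rewrite -sum1_card (big_setID C) /= (setIidPr CG).
rewrite [X in _ + X]big1 ?addn0; last by move=> x; rewrite inE => /andP[/negbTE->].
by apply: eq_bigr => x ->.
Qed.

End Graphs.

Ltac edge_simp :=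
  rewrite ?inE ?edge_eq ?eqxx;
  repeat match goal with
  | H : is_true (?x != ?y) |- context [?x == ?y] => rewrite (negbTE H)
  | H : is_true (?x != ?y) |- context [?y == ?x] =>
      rewrite (eq_sym y x) (negbTE H)
  end; rewrite ?eqxx ?andbF ?andbT ?orbF ?orbT /=.

Section Properties.

Variable T : finType.
Implicit Types (F : {set {set T}} -> bool) (G H K Z : {set {set T}}).
Implicit Types (a b u v w x y z : T) (e : {set T}).

Definition invariant F := forall (s : {perm T}) G G',
  (forall a b, a != b -> (s a -- s b \in G') = (a -- b \in G)) -> F G = F G'.

Definition low_sens F k := forall G (D : {set {set T}}),
  (forall e, e \in D -> #|e| = 2) ->
  (forall e, e \in D -> (F (G :\ e) != F G) || (F (e |: G) != F G)) ->
  #|D| < k.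

Definition twin Z y y' := forall b, b != y -> b != y' ->
  (y -- b \in Z) = (y' -- b \in Z).

Variables (F : {set {set T}} -> bool) (k : nat).
Hypotheses (Finv : invariant F) (Fsens : low_sens F k).

Lemma F_eq G G' :
  (forall a b, a != b -> (a -- b \in G') = (a -- b \in G)) -> F G = F G'.
Proof. by move=> E; apply: (Finv (s := 1%g)) => a b ab; rewrite !perm1 E. Qed.

Lemma F_swap u w G G' :
    (forall b, b != u -> b != w -> (u -- b \in G') = (w -- b \in G)) ->
    (forall b, b != u -> b != w -> (w -- b \in G') = (u -- b \in G)) ->
    (forall a b, a != b -> a != u -> a != w -> b != u -> b != w ->
      (a -- b \in G') = (a -- b \in G)) ->
    (u -- w \in G') = (u -- w \in G) ->
  F G = F G'.
Proof.
move=> E1 E2 E3 E4; apply: (Finv (s := tperm u w)) => a b.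
case: tpermP => [->|->|/eqP au /eqP aw]; case: tpermP => [->|->|/eqP bu /eqP bw];
  rewrite ?eqxx // => ab.
- by rewrite (edgeC w u) E4.
- by rewrite E2.
- by rewrite E4 (edgeC u w).
- by rewrite E1.
- by rewrite (edgeC _ w) E2 1?edgeC.
- by rewrite (edgeC _ u) E1 1?edgeC.
- by rewrite E3.
Qed.

Lemma flips_lt G (A : {set {set T}}) (P : {set T * T}) (S : {set T}) :
    (forall e, e \in A -> #|e| = 2) ->
    (forall e, e \in A -> F (G :\ e) != F G) ->
    P \subset setX S (~: S) ->
    (forall x y, (x, y) \in P -> F (x -- y |: G) != F G) ->
  #|A| + #|P| < k.
Proof.
move=> A2 AF PS PF.
pose B := [set p.1 -- p.2 | p in P].
have cB : #|B| = #|P|.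
  apply: card_in_imset => -[x y] [x' y'] /= xyP xyP' /eqP.
  rewrite edge_eq => /orP[/andP[/eqP-> /eqP->] //|/andP[/eqP E /eqP E']].
  move: (subsetP PS _ xyP) (subsetP PS _ xyP').
  by rewrite !inE /= E E' => /andP[-> _] /andP[_]; rewrite ?andbF.
rewrite -cB -cardsUI disjoint_setI0 ?cards0 ?addn0; last first.
  apply/pred0P => e /=; apply/negP=> /andP[eA /imsetP[[x y] xyP /= Ee]].
  have := AF e eA; have := PF _ _ xyP; rewrite -Ee.
  case: (boolP (e \in G)) => eG; first by rewrite (setUidPr _) ?sub1set ?eqxx.
  by rewrite setD1_notin ?eqxx.
apply: (Fsens (G := G)) => e; rewrite inE => /orP[eA|/imsetP[[x y] xyP ->]].
- exact: A2.
- apply/eqP; rewrite card_edge; move: (subsetP PS _ xyP); rewrite !inE /=.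
  by case: eqVneq => // ->; case: (y \in S).
- by rewrite AF.
- by rewrite PF ?orbT.
Qed.

Lemma added_flips_lt G (P : {set T * T}) (S : {set T}) :
    P \subset setX S (~: S) ->
    (forall x y, (x, y) \in P -> F (x -- y |: G) != F G) ->
  #|P| < k.
Proof.
move=> PS PF; rewrite -[#|P|]add0n -(cards0 {set T}).
by apply: flips_lt PS PF => e; rewrite inE.
Qed.

Lemma twin_swap Z y y' x : twin Z y y' -> x != y -> x != y' ->
  F (y -- x |: Z) = F (y' -- x |: Z).
Proof.
move=> tw xy xy'; have [->//|yy'] := eqVneq y y'.
apply: (F_swap (u := y) (w := y')).
- by move=> b by1 by2; edge_simp; rewrite tw.
- by move=> b by1 by2; edge_simp; rewrite tw.
- by move=> a b ab ay ay' by1 by2; edge_simp.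
- by edge_simp.
Qed.

Lemma twin_notin_supp Z y y' : y \notin supp Z -> y' \notin supp Z -> twin Z y y'.
Proof. by move=> yZ y'Z b by1 by2; rewrite !notin_supp. Qed.

Lemma iso_swap Z y y' x : y \notin supp Z -> y' \notin supp Z -> x != y ->
  x != y' -> F (y -- x |: Z) = F (y' -- x |: Z).
Proof. by move=> yZ y'Z; apply: twin_swap; apply: twin_notin_supp. Qed.

Section Minimal.

Variable G : {set {set T}}.
Hypothesis minG : minset F G.

Lemma minimal_true : F G.
Proof. by case/minsetP: minG. Qed.

Lemma minimal_sub K : K \subset G -> K != G -> F K = false.
Proof.
move=> KG nKG; apply/negP=> FK; case/minsetP: minG => _ /(_ K FK KG) E.
by rewrite E eqxx in nKG.
Qed.

Lemma minimal_del e : e \in G -> F (G :\ e) = false.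
Proof.
move=> eG; apply: minimal_sub (subD1set _ _) _.
by apply: contraTneq eG => <-; rewrite !inE eqxx.
Qed.

Lemma minimal_meets K Y e : minset F K -> e \in G -> K \subset (G :\ e) :|: Y ->
  exists2 e', e' \in K & e' \in Y.
Proof.
move=> minK eG KY; have [KG|/subsetPn[e' e'K e'G]] := boolP (K \subset G :\ e).
  have FK : F K by case/minsetP: minK.
  have KsG := subset_trans KG (subD1set G e).
  rewrite minimal_sub // in FK; apply: contraTneq eG => E.
  by apply/negP=> eG; have := subsetP KG e; rewrite E eG !inE eqxx => /(_ isT).
by exists e' => //; have := subsetP KY e' e'K; rewrite in_setU (negbTE e'G).
Qed.

Lemma minimal_edge e : e \in G -> #|e| = 2.
Proof.
move=> eG; apply/eqP/negPn/negP => e2.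
have := minimal_del eG; rewrite -(@F_eq G) ?minimal_true // => a b ab.
rewrite !inE; case: eqVneq => // E; rewrite -E card_edge ab in e2.
by [].
Qed.

Lemma minimal_edgeP e : e \in G -> exists x y, x != y /\ e = x -- y.
Proof.
by move=> /minimal_edge/eqP/cards2P[x [y [xy ->]]]; exists x, y.
Qed.

Lemma minimal_card : #|G| < k.
Proof.
rewrite -[#|G|]addn0 -(cards0 (T * T)%type).
apply: (@flips_lt G G set0 set0) minimal_edge _ (sub0set _) _ => [e eG|x y].
  by rewrite minimal_true minimal_del.
by rewrite inE.
Qed.

Lemma card_supp_le : #|supp G| <= 2 * #|G|.
Proof.
rewrite -(handshake minimal_edge) -sum1_card leq_sum // => x.
by rewrite inE card_gt0.
Qed.

Hypothesis kT : 2 * k <= #|T|.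

Lemma card_iso : #|~: supp G| + #|supp G| = #|T|.
Proof. by rewrite addnC cardsC. Qed.

Lemma minimal_pendant w x : w \notin supp G -> x \in supp G -> F (w -- x |: G).
Proof.
move=> wG xG; apply/negPn/negP => /negbTE Fwx.
suff: #|G| + #|setX (~: supp G) [set x]| < k.
  rewrite cardsX cards1 muln1.
  move: minimal_card card_supp_le card_iso kT; lia.
apply: (@flips_lt G G _ (~: supp G)) minimal_edge _ _ _.
- by move=> e eG; rewrite minimal_true minimal_del.
- by apply: setXS; rewrite ?sub1set ?setCK.
move=> y z; rewrite !inE /= => /andP[yG /eqP->].
rewrite minimal_true (@iso_swap G y w) ?Fwx //.
- by rewrite !inE.
- by apply: contraTneq xG => ->; rewrite !inE.
- by apply: contraTneq xG => ->; exact: wG.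
Qed.

Lemma minimal_leaf_iso u : u \in leaf G -> #|~: supp G|.+1 < k.
Proof.
move=> uG; have [v Nu] := leaf_nb uG.
have /andP[vu uvG] : (v != u) && (u -- v \in G) by rewrite -in_nb Nu set11.
have vG : v \in supp G by rewrite (@in_supp _ _ _ u) 1?edgeC.
have uS := subsetP (leaf_supp G) u uG.
pose W := u |: ~: supp G.
have uH := leaf_del_supp Nu.
have WH w : w \in W -> w \notin supp (G :\ (u -- v)).
  rewrite 2!inE => /orP[/eqP-> //|]; rewrite inE; apply: contra.
  exact/subsetP/supp_sub/subD1set.
have vW : v \notin W by rewrite !inE (negbTE vu) /=; move: vG; rewrite inE => ->.
suff: #|setX W [set v]| < k by rewrite cardsX cards1 muln1 cardsU1 inE uS.
apply: (@added_flips_lt (G :\ (u -- v)) _ W).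
  by apply: setXS; rewrite ?sub1set ?in_setC.
move=> w z; rewrite inE /= => /andP[wW]; rewrite inE => /eqP->.
have vw : v != w by apply: contraNneq vW => ->.
rewrite (@iso_swap _ w u) ?WH ?setU11 //.
by rewrite setD1K // minimal_true minimal_del.
Qed.

End Minimal.

End Properties.

(** * Leafless minimal graphs *)

Section Rows.

Variable T : finType.
Implicit Types (G K Z : {set {set T}}) (Fr A B : {set T}).
Implicit Types (r : {ffun T -> {set T}}) (a b u v w x y z : T) (e : {set T}).

Definition row_edges r : {set {set T}} :=
  [set e | [exists w, exists x, (x \in r w) && (e == w -- x)]].

Definition rows_on B Fr d r :=
  [forall w, [&& r w \subset B, #|r w| <= d & (r w != set0) ==> (w \in Fr)]].

Lemma row_edgesP r e :
  reflect (exists w x, x \in r w /\ e = w -- x) (e \in row_edges r).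
Proof.
rewrite inE; apply: (iffP existsP) => [[w /existsP[x /andP[xw /eqP->]]]|].
  by exists w, x.
by case=> w [x [xw ->]]; exists w; apply/existsP; exists x; rewrite xw eqxx.
Qed.

Lemma in_row_edges r a b : (a -- b \in row_edges r) = (b \in r a) || (a \in r b).
Proof.
apply/row_edgesP/orP => [[w [x [xw /eqP]]]|[ba|ab]].
- by rewrite edge_eq => /orP[]/andP[/eqP-> /eqP->]; [left | right].
- by exists a, b.
- by exists b, a; rewrite edgeC.
Qed.

Lemma row_edgesU r r' :
  row_edges [ffun w => r w :|: r' w] = row_edges r :|: row_edges r'.
Proof.
apply/setP=> e; rewrite [RHS]inE; apply/row_edgesP/orP.
  case=> w [x []]; rewrite ffunE inE => /orP[xr|xr] ->; [left | right];
  by apply/row_edgesP; exists w, x.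
by case=> /row_edgesP[w [x [xr ->]]]; exists w, x; rewrite ffunE inE xr ?orbT.
Qed.

Lemma rows_onP B Fr d r :
  reflect (forall w, [/\ r w \subset B, #|r w| <= d & r w != set0 -> w \in Fr])
          (rows_on B Fr d r).
Proof.
apply: (iffP forallP) => ok w; first by case/and3P: (ok w) => ? ? /implyP.
by case: (ok w) => -> -> /implyP.
Qed.

Lemma rows_on0 B Fr d : rows_on B Fr d [ffun=> set0].
Proof. by apply/rows_onP=> w; rewrite ffunE sub0set cards0 eqxx. Qed.

Lemma row_edges0 : row_edges [ffun=> set0] = set0.
Proof.
apply/setP=> e; rewrite [RHS]inE; apply/row_edgesP=> -[w [x [] ]].
by rewrite ffunE inE.
Qed.

Variable B : {set T}.

Lemma rows_onU Fr Fr' d d' r r' : [disjoint Fr & Fr'] ->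
  rows_on B Fr d r -> rows_on B Fr' d' r' ->
  rows_on B (Fr :|: Fr') (maxn d d') [ffun w => r w :|: r' w].
Proof.
move=> dis /rows_onP ok /rows_onP ok'; apply/rows_onP=> w; rewrite ffunE.
have [s c i] := ok w; have [s' c' i'] := ok' w; split.
- by rewrite subUset s s'.
- have [E|/i wF] := eqVneq (r w) set0.
    by rewrite E set0U (leq_trans c') ?leq_maxr.
  have [E|/i' wF'] := eqVneq (r' w) set0.
    by rewrite E setU0 (leq_trans c) ?leq_maxl.
  by have := disjointFr dis wF; rewrite wF'.
- rewrite setU_eq0 negb_and inE.
  by case/orP=> [/i->|/i'->]; rewrite ?orbT.
Qed.

Lemma rows_onW Fr Fr' d d' r : Fr \subset Fr' -> d <= d' ->
  rows_on B Fr d r -> rows_on B Fr' d' r.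
Proof.
move=> sF sd /rows_onP ok; apply/rows_onP=> w; have [s c i] := ok w; split=> //.
  exact: leq_trans sd.
by move/i; apply: subsetP.
Qed.

Lemma row_edges_disjoint Fr d r Z : rows_on B Fr d r -> [disjoint Fr & B] ->
  [disjoint Fr & supp Z] -> [disjoint Z & row_edges r].
Proof.
move=> /rows_onP ok dB dZ; apply/pred0P=> e /=; apply/negP=> /andP[eZ].
case/row_edgesP=> w [x [xw Ee]]; have [s _ i] := ok w.
have wF : w \in Fr by apply: i; apply/set0Pn; exists x.
have xB := subsetP s x xw.
have xw' : x != w by apply: contraTneq wF => <-; rewrite (disjointFl dB).
have wZ : w \notin supp Z by rewrite (disjointFr dZ wF).
by have := notin_supp wZ xw'; rewrite -Ee eZ.
Qed.

Lemma row_edges_del Fr d r w0 x0 : rows_on B Fr d r -> [disjoint Fr & B] ->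
  x0 \in r w0 ->
  row_edges r :\ (w0 -- x0) =
  row_edges [ffun w => if w == w0 then r w :\ x0 else r w].
Proof.
move=> /rows_onP ok dB x0w; apply/setP=> e; rewrite in_setD1.
apply/andP/row_edgesP => [[ne /row_edgesP[w [x [xw Ee]]]]|[w [x []]]].
  exists w, x; split=> //; rewrite ffunE; case: eqVneq => // Ew.
  by rewrite !inE xw andbT; apply: contraNneq ne => Ex; rewrite Ee Ew Ex.
rewrite ffunE => xw ->; split; last first.
  apply/row_edgesP; exists w, x; split=> //.
  by move: xw; case: ifP => // _; rewrite inE => /andP[].
rewrite edge_eq; apply/negP=> /orP[/andP[/eqP Ew /eqP Ex]|/andP[/eqP Ew _]].
  by rewrite Ew Ex eqxx !inE eqxx in xw.
have [s _ i] := ok w0; have [s' _ i'] := ok w.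
have xw' : x \in r w by move: xw; case: ifP => // _; rewrite inE => /andP[].
have wF : w \in Fr by apply: i'; apply/set0Pn; exists x.
by have := disjointFr dB wF; rewrite Ew (subsetP s).
Qed.

Lemma card_row_edges Fr d r A : rows_on B Fr d r -> [disjoint Fr & B] ->
  (forall w, w \in A -> r w != set0) -> #|A| <= #|row_edges r|.
Proof.
move=> /rows_onP ok dB rA.
pose g w := odflt w [pick x in r w].
have gP w : w \in A -> g w \in r w.
  by move=> /rA/set0Pn[x xw]; rewrite /g; case: pickP => //= /(_ x); rewrite xw.
rewrite -(@card_in_imset _ _ (fun w => w -- g w)).
  apply/subset_leq_card/subsetP=> e /imsetP[w wA ->].
  by apply/row_edgesP; exists w, (g w); rewrite gP.
move=> w w' wA w'A /eqP; rewrite edge_eq => /orP[/andP[/eqP]//|].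
case/andP=> /eqP E _; have [s' _ _] := ok w'.
have [_ _ i] := ok w; have := disjointFr dB (i (rA w wA)).
by rewrite E (subsetP s') ?gP.
Qed.

Variables (F : {set {set T}} -> bool) (k : nat).
Hypotheses (Finv : invariant F) (Fsens : low_sens F k).

(* The deletions in [D1] and [D2] remain sensitive whatever rows are added, so
   they count against the budget [k] at every point of the exchange argument. *)
Lemma rows_constant d Z Fr (D1 D2 : {set {set T}}) c :
    [disjoint Fr & B] -> [disjoint Fr & supp Z] ->
    (forall e, e \in D1 :|: D2 -> #|e| = 2) -> D1 :|: D2 \subset Z ->
    F Z = c ->
    (forall e r, e \in D1 -> rows_on B Fr d r ->
      F ((Z :\ e) :|: row_edges r) = ~~ c) ->
    (forall e r, e \in D2 -> rows_on B Fr d r ->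
      F ((Z :\ e) :|: row_edges r) = c) ->
    2 * k <= #|Fr| + #|D1| + #|D2| + 2 ->
  forall r, rows_on B Fr d r -> F (Z :|: row_edges r) = c.
Proof.
elim: d Z Fr D1 D2 c => [|d IH] Z Fr D1 D2 c dB dZ De DZ FZ FD1 FD2 kFD r0 ok0.
  rewrite -FZ (_ : row_edges r0 = set0) ?setU0 // -row_edges0; congr row_edges.
  apply/ffunP=> w; rewrite ffunE; apply/eqP; move/rows_onP: ok0 => /(_ w)[_].
  by rewrite leqn0 cards_eq0.
apply/eqP/negPn/negP=> F0.
pose big r := [set w | #|r w| == d.+1].
pose bad r := rows_on B Fr d.+1 r && (F (Z :|: row_edges r) != c).
have bad0 : bad r0 by rewrite /bad ok0.
have [r /andP[ok Fr_c] rmin] := arg_minnP (fun r => #|big r|) bad0.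
have {}rmin r' : rows_on B Fr d.+1 r' -> #|big r'| < #|big r| ->
    F (Z :|: row_edges r') = c.
  move=> ok' lt; apply/eqP/negPn/negP=> F'; move: lt.
  by rewrite ltnNge rmin // /bad ok' F'.
have {Fr_c} FrN : F (Z :|: row_edges r) = ~~ c by move: Fr_c; case: (F _); case: (c).
have /rows_onP okP := ok.
pose A := big r.
have AF : A \subset Fr.
  apply/subsetP=> w; rewrite inE => /eqP wA; have [_ _] := okP w; apply.
  by rewrite -card_gt0 wA.
pose ra := [ffun w => if w \in A then r w else set0].
pose rl := [ffun w => if w \in A then set0 else r w].
have raE w : w \in A -> ra w = r w by move=> wA; rewrite ffunE wA.
have Er : row_edges r = row_edges ra :|: row_edges rl.
  rewrite -row_edgesU; congr row_edges; apply/ffunP=> w; rewrite !ffunE.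
  by case: ifP; rewrite ?setU0 ?set0U.
pose Fr' := Fr :\: A.
have okra : rows_on B A d.+1 ra.
  apply/rows_onP=> w; have [s cw _] := okP w; rewrite ffunE.
  by case: ifP => wA; split; rewrite ?sub0set ?cards0 ?eqxx.
have okrl : rows_on B Fr' d rl.
  apply/rows_onP=> w; have [s cw i] := okP w; rewrite ffunE.
  case: ifP => wA; split; rewrite ?sub0set ?cards0 ?eqxx //.
    by rewrite -ltnS ltn_neqAle cw andbT; move: wA; rewrite inE => ->.
  by move=> /i wF; rewrite inE wA.
have dAF : [disjoint A & Fr'].
  by apply/pred0P=> w /=; rewrite in_setD; case: (w \in A).
have AFF : A :|: Fr' = Fr.
  apply/setP=> w; rewrite in_setU in_setD; case wA: (w \in A) => //=.
  by rewrite (subsetP AF).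
have dAB : [disjoint A & B] by apply: disjointWl dB.
have dAZ : [disjoint A & supp Z] by apply: disjointWl dZ.
have okU r' : rows_on B Fr' d r' ->
    rows_on B Fr d.+1 [ffun w => ra w :|: r' w].
  move=> ok'; have := rows_onU dAF okra ok'; rewrite AFF.
  by apply: rows_onW => //; rewrite geq_max leqnn leqnSn.
pose Z' := Z :|: row_edges ra.
have dra := row_edges_disjoint okra dAB dAZ.
have Z'D e r' : e \in Z -> (Z' :\ e) :|: row_edges r' =
    (Z :\ e) :|: row_edges [ffun w => ra w :|: r' w].
  move=> eZ; rewrite row_edgesU setUA setDUl; congr (_ :|: _ :|: _).
  by rewrite setD1_notin // (disjointFr dra eZ).
have Z'A e r' : e \in row_edges ra -> rows_on B Fr' d r' ->
    F ((Z' :\ e) :|: row_edges r') = c.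
  move=> eA ok'; have /row_edgesP[w0 [x0 [x0w Ee]]] := eA.
  have eZ : e \notin Z by rewrite (disjointFl dra eA).
  rewrite setDUl (setD1_notin eZ).
  rewrite -setUA Ee (row_edges_del okra dAB x0w) -row_edgesU.
  have w0A : w0 \in A by move: x0w; rewrite ffunE; case: ifP => // _; rewrite inE.
  apply: rmin.
    apply/rows_onP=> w; have /rows_onP/(_ w) := okU _ ok'; rewrite !ffunE => -[s cw i].
    case: eqVneq => // Ew; split.
    - by apply: subset_trans s; rewrite setSU ?subsetDl.
    - by apply: leq_trans cw; rewrite subset_leq_card // setSU ?subsetDl.
    - by move=> _; apply: (subsetP AF); rewrite Ew.
  apply: proper_card; apply/properP; split.
    apply/subsetP=> w; rewrite [w \in _]inE !ffunE => Ew.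
    case wA: (w \in A) => //.
    have [_ cw _] := (rows_onP _ _ _ _ ok') w; move: Ew; rewrite wA.
    by rewrite set0D if_same set0U => /eqP E; rewrite E ltnn in cw.
  exists w0 => //; rewrite inE !ffunE eqxx w0A.
  have -> : r' w0 = set0.
    have [_ _ i] := (rows_onP _ _ _ _ ok') w0; apply/eqP/negPn/negP=> /i.
    by rewrite in_setD w0A.
  rewrite setU0; move: w0A; rewrite inE => /eqP <-.
  rewrite (cardsD1 x0 (r w0)) -(raE w0) ?x0w ?add1n; first by rewrite neq_ltn ltnSn.
  by move: x0w; rewrite ffunE; case: ifP => // _; rewrite inE.
have dF'B : [disjoint Fr' & B] by apply: disjointWl dB; apply: subsetDl.
have suppZ' : [disjoint Fr' & supp Z'].
  apply/pred0P=> w /=; apply/negP=> /andP[wF]; rewrite inE => /set0Pn[y].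
  have [wF0 wA] : w \in Fr /\ w \notin A by apply/andP; rewrite andbC -in_setD.
  rewrite in_nb in_setU => /andP[yw]; rewrite notin_supp ?(disjointFr dZ) //=.
  rewrite in_row_edges !ffunE (negbTE wA) in_set0 /=; case: ifP => yA; rewrite ?in_set0 //.
  by move=> wy; have [/subsetP/(_ w wy)] := okP y; rewrite (disjointFr dB).
pose DA := D2 :|: row_edges ra.
have cDA : #|D2| + #|A| <= #|DA|.
  rewrite -(leq_add2r #|D2 :&: row_edges ra|) cardsUI disjoint_setI0; last first.
    by apply: disjointWl dra; apply: subset_trans DZ; apply: subsetUr.
  rewrite cards0 addn0 leq_add2l; apply: card_row_edges okra dAB _ => w wA.
  by rewrite raE // -card_gt0; move: wA; rewrite inE => /eqP->.
have DA2 e : e \in DA -> #|e| = 2.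
  rewrite in_setU => /orP[eD|]; first by apply: De; rewrite in_setU eD orbT.
  case/row_edgesP=> w [x [xw ->]]; apply/eqP; rewrite card_edge.
  move: xw; rewrite ffunE; case: ifP => [wA|_]; last by rewrite in_set0.
  move=> xw; have [/subsetP/(_ x xw) xB _ _] := okP w.
  by apply: contraTneq xB => <-; rewrite (disjointFr dAB).
have D1Z e : e \in D1 -> e \in Z by move=> eD; apply: (subsetP DZ); rewrite in_setU eD.
have D2Z e : e \in D2 -> e \in Z.
  by move=> eD; apply: (subsetP DZ); rewrite in_setU eD orbT.
have FDA e r' : e \in DA -> rows_on B Fr' d r' ->
    F ((Z' :\ e) :|: row_edges r') = c.
  rewrite in_setU => /orP[eD|eA] ok'; last exact: Z'A.
  by rewrite Z'D ?D2Z //; apply: FD2 => //; apply: okU.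
have FD1' e r' : e \in D1 -> rows_on B Fr' d r' ->
    F ((Z' :\ e) :|: row_edges r') = ~~ c.
  by move=> eD ok'; rewrite Z'D ?D1Z //; apply: FD1 => //; apply: okU.
have DAZ' : DA \subset Z' by rewrite setSU //; apply/subsetP=> e /D2Z.
have D1Z' : D1 \subset Z'.
  by apply: subset_trans (subsetUl _ _); apply/subsetP=> e /D1Z.
have cF' : #|Fr'| + #|A| = #|Fr|.
  by rewrite addnC -cardsUI AFF disjoint_setI0 // cards0 addn0.
have Z'const r' : rows_on B Fr' d r' -> F (Z' :|: row_edges r') = F Z'.
  case FZ' : (F Z' == c).
    apply: (IH Z' Fr' D1 DA (F Z') dF'B suppZ') => //.
    - by move=> e; rewrite in_setU => /orP[eD|/DA2//]; apply: De; rewrite in_setU eD.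
    - by rewrite subUset D1Z'.
    - by rewrite (eqP FZ').
    - by rewrite (eqP FZ').
    - by move: cDA cF' kFD; move: #|DA| #|Fr'| #|A| #|Fr| #|D1| #|D2|; clear; lia.
  have {}FZ' : F Z' = ~~ c by move: FZ'; case: (F Z'); case: (c).
  apply: (IH Z' Fr' DA D1 (F Z') dF'B suppZ') => //.
  - by move=> e; rewrite in_setU => /orP[/DA2//|eD]; apply: De; rewrite in_setU eD.
  - by rewrite subUset D1Z' andbT.
  - by rewrite FZ' negbK.
  - by rewrite FZ'.
    - by move: cDA cF' kFD; move: #|DA| #|Fr'| #|A| #|Fr| #|D1| #|D2|; clear; lia.
have FZ' : F Z' = ~~ c by rewrite -(Z'const rl) // -FrN Er setUA.
have flips1 : #|DA| < k.
  rewrite -[#|DA|]addn0 -(cards0 (T * T)%type).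
  apply: (flips_lt Fsens (G := Z') DA2 _ (sub0set (setX set0 _))) => [e eD|x y]; last by rewrite inE.
  have := FDA e _ eD (rows_on0 _ _ _); rewrite row_edges0 setU0 FZ' => ->.
  by case: (c).
have [w0 w0A] : exists w0, w0 \in A.
  apply/set0Pn; apply: contraPneq FZ' => A0.
  rewrite /Z' (_ : ra = [ffun=> set0]) ?row_edges0 ?setU0 ?FZ; first by case: (c).
  by apply/ffunP=> w; rewrite !ffunE A0 in_set0.
have [x0 x0w] : exists x0, x0 \in r w0.
  by apply/set0Pn; rewrite -card_gt0; move: w0A; rewrite inE => /eqP->.
pose S := r w0 :\ x0.
have w0F := subsetP AF w0 w0A.
have cS : #|S| = d.
  by move: w0A; rewrite inE (cardsD1 x0) x0w add1n => /eqP[].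
have SB : S \subset B by apply: subset_trans (subsetDl _ _) _; case: (okP w0).
pose r1 := [ffun w => if w \in Fr' then S else set0].
have ok1 : rows_on B Fr' d r1.
  apply/rows_onP=> w; rewrite ffunE; case: ifP => wF; split;
  by rewrite ?sub0set ?cards0 ?eqxx ?cS.
have ra0 : x0 \in ra w0 by rewrite raE.
pose ed := w0 -- x0.
have edA : ed \in row_edges ra by rewrite in_row_edges ra0.
pose Y := (Z' :\ ed) :|: row_edges r1.
have FY : F Y = c by apply: Z'A.
have x0B : x0 \in B by have [/subsetP/(_ x0 x0w)] := okP w0.
pose W := w0 |: Fr'.
have WF : W \subset Fr by rewrite subUset sub1set w0F subsetDl.
have x0W : x0 \notin W.
  by apply/negP=> /(subsetP WF) xF; have := disjointFr dB xF; rewrite x0B.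
have inY w b : w \in W -> b != w -> (w -- b \in Y) = (b \in S).
  move=> wW bw; have wF := subsetP WF w wW.
  have wB : w \notin B by rewrite (disjointFr dB wF).
  rewrite /Y in_setU in_setD1 in_setU notin_supp ?(disjointFr dZ) //=.
  rewrite !in_row_edges.
  have -> : (w \in ra b) = false.
    rewrite ffunE; case: ifP => _; rewrite ?in_set0 //; apply/negP=> wb.
    by have [/subsetP/(_ w wb)] := okP b; rewrite (negbTE wB).
  have -> : (w \in r1 b) = false.
    rewrite ffunE; case: ifP => _; rewrite ?in_set0 //; apply/negP=> wb.
    by have := subsetP SB w wb; rewrite (negbTE wB).
  rewrite !orbF !ffunE; move: wW; rewrite in_setU1 => /orP[/eqP Ew|wF'].
    have wF' : w \in Fr' = false by rewrite Ew in_setD w0A.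
    have wA : w \in A by rewrite Ew.
    rewrite wF' wA in_set0 orbF /ed edge_eq Ew eqxx in_setD1 /=.
    by rewrite Ew in bw; rewrite (negbTE bw) andbF orbF.
  have wA : w \in A = false by apply: (disjointFl dAF).
  by rewrite wF' wA in_set0 andbF.
have flips2 : #|D1| + #|setX W [set x0]| < k.
  apply: (flips_lt Fsens (G := Y) (S := W)).
  - by move=> e eD; apply: De; rewrite in_setU eD.
  - move=> e eD; rewrite FY.
    have eZ := D1Z e eD.
    have E2 : row_edges ra :\ ed = row_edges [ffun w => if w == w0 then ra w :\ x0 else ra w].
      exact: row_edges_del okra dAB ra0.
    have edZ : ed \notin Z by rewrite (disjointFl dra edA).
    pose r2 := [ffun w => [ffun w => if w == w0 then ra w :\ x0 else ra w] w :|: r1 w].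
    have ok2 : rows_on B Fr d.+1 r2.
      apply/rows_onP=> w; have /rows_onP/(_ w) := okU _ ok1; rewrite !ffunE => -[s cw i].
      case: eqVneq => // Ew; split.
      - by apply: subset_trans s; rewrite setSU ?subsetDl.
      - by apply: leq_trans cw; rewrite subset_leq_card // setSU ?subsetDl.
      - by move=> _; apply: (subsetP AF); rewrite Ew.
    have -> : Y = Z :|: row_edges r2.
      rewrite /Y /r2 row_edgesU -E2 setUA; congr (_ :|: _); rewrite setDUl.
      by rewrite (setD1_notin edZ).
    have d2 := row_edges_disjoint ok2 dB dZ.
    have er2 : e \notin row_edges r2 by rewrite (disjointFr d2 eZ).
    rewrite setDUl (setD1_notin er2).
    by rewrite FD1 //; case: (c).
  - by apply: setXS => //; rewrite sub1set in_setC.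
  move=> w x; rewrite in_setX in_set1 /= => /andP[wW /eqP->].
  have x0w' : x0 != w by apply: contraNneq x0W => ->.
  have x0w0 : x0 != w0 by apply: contraNneq x0W => ->; rewrite setU11.
  rewrite (@twin_swap _ _ Finv Y w w0) //; last first.
    by move=> b bw bw0; rewrite !inY ?setU11.
  have -> : ed |: Y = Z' :|: row_edges r1.
    by rewrite /Y setUA setD1K // in_setU edA orbT.
  by rewrite Z'const // FZ' FY; case: (c).
move: flips2; rewrite cardsX cards1 muln1 cardsU1 in_setD w0A /=.
by move: cDA cF' kFD flips1; move: #|DA| #|Fr'| #|A| #|Fr| #|D1| #|D2|; clear; lia.
Qed.


End Rows.

Section Leafless.

Variables (T : finType) (F : {set {set T}} -> bool) (k : nat).
Hypotheses (Finv : invariant F) (Fsens : low_sens F k) (kT : 2 * k <= #|T|).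

Lemma minimal_degree_le1 G u : minset F G -> u \in supp G ->
  (forall K x, minset F K -> x \in supp K -> #|nb G u| <= #|nb K x|) ->
  #|nb G u| <= 1.
Proof.
move=> minG uG umin; rewrite leqNgt; apply/negP=> d2.
have G2 := minimal_edge Finv minG.
set d := #|nb G u| in d2 umin.
pose Fr := ~: supp G.
have tm : #|supp G| <= #|G|.
  rewrite -(leq_pmul2l (ltn0Sn 1)) -(handshake G2) mulnC -sum_nat_const.
  by apply: leq_sum => x xG; apply: leq_trans d2 (umin G x minG xG).
have dFr : [disjoint Fr & supp G] by rewrite disjoints_subset.
have FrG w : w \in Fr -> w \notin supp G by rewrite in_setC.
have GD e r : e \in G -> rows_on (supp G) Fr d.-1 r ->
    F ((G :\ e) :|: row_edges r) = false.
  move=> eG /rows_onP ok; apply/negP=> FX; have [K minK KX] := minset_exists FX.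
  have [e' e'K] := minimal_meets minG minK eG KX.
  case/row_edgesP=> w [x [xw Ee]]; have [s c i] := ok w.
  have wF : w \in Fr by apply: i; apply/set0Pn; exists x.
  have wx : w != x.
    by apply: contraTneq (subsetP s x xw) => <-; apply: FrG.
  have wK : w \in supp K by rewrite (in_supp wx) // -Ee.
  have : #|nb K w| <= #|r w|.
    apply/subset_leq_card/subsetP=> y; rewrite in_nb => /andP[yw /(subsetP KX)].
    rewrite in_setU in_setD1 (notin_supp (FrG _ wF)) // andbF /= in_row_edges.
    case/orP=> // wy; have [/subsetP/(_ w wy)] := ok y.
    by rewrite (negbTE (FrG _ wF)).
  have := umin K w minK wK; move: c d2; move: #|r w| #|nb K w| (d); clear; lia.
have GA r : rows_on (supp G) Fr d.-1 r -> F (G :|: row_edges r) = true.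
  apply: (rows_constant Finv Fsens dFr dFr (D1 := G) (D2 := set0)).
  - by rewrite setU0.
  - by rewrite setU0.
  - exact: minimal_true minG.
  - by move=> e r' eG; apply: GD.
  - by move=> e r'; rewrite in_set0.
  - rewrite cards0; have := cardsC (supp G); rewrite -/Fr.
    by move: kT tm; move: #|Fr| #|supp G| #|G| #|T|; clear; lia.
have [v vu] : exists v, v \in nb G u by apply/set0Pn; rewrite -card_gt0 ltnW.
have /andP[vNu uvG] : (v != u) && (u -- v \in G) by rewrite -in_nb.
pose S := nb G u :\ v; pose r := [ffun w => if w \in Fr then S else set0].
have cS : #|S| = d.-1 by rewrite /d (cardsD1 v (nb G u)) vu.
have SG : S \subset supp G.
  apply/subsetP=> x; rewrite in_setD1 in_nb => /and3P[_ xu uxG].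
  by rewrite (in_supp xu) // edgeC.
have ok : rows_on (supp G) Fr d.-1 r.
  apply/rows_onP=> w; rewrite ffunE.
  by case: ifP => wF; split; rewrite ?sub0set ?cards0 ?eqxx ?cS.
pose Y := (G :\ (u -- v)) :|: row_edges r.
have FY : F Y = false by apply: GD.
pose W := u |: Fr.
have uF : u \notin Fr by rewrite in_setC negbK.
have vG : v \in supp G by rewrite (in_supp vNu) // edgeC.
have vW : v \notin W by rewrite in_setU1 (negbTE vNu) in_setC negbK.
have notr w b : w \in W -> b != w -> (w \in r b) = ((w == u) && (b \in Fr) && (u \in S)).
  rewrite in_setU1 ffunE => /orP[/eqP->|wF] bw.
    by rewrite eqxx; case: ifP; rewrite ?in_set0.
  have -> : (w == u) = false by apply: contraNF uF => /eqP <-.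
  case: ifP => _; rewrite ?in_set0 //; apply/negP=> /(subsetP SG).
  by apply/negP; apply: FrG.
have uS : u \notin S by rewrite in_setD1 in_nb eqxx andbF.
have inY w b : w \in W -> b != w -> (w -- b \in Y) = (b \in S).
  move=> wW bw; rewrite in_setU in_setD1 in_row_edges (notr w b) // (negbTE uS) andbF orbF.
  move: wW; rewrite in_setU1 => /orP[/eqP Ew|wF].
    rewrite Ew in bw *; rewrite ffunE (negbTE uF) in_set0 orbF edge_eq eqxx.
    by rewrite (negbTE bw) andbF orbF in_setD1 in_nb bw.
  by rewrite (notin_supp (FrG _ wF)) // andbF ffunE wF.
have : #|setX W [set v]| < k.
  apply: (added_flips_lt Fsens (G := Y) (S := W)).
    by apply: setXS => //; rewrite sub1set in_setC.
  move=> w x; rewrite in_setX in_set1 /= => /andP[wW /eqP->].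
  have vw : v != w by apply: contraNneq vW => ->.
  rewrite (@twin_swap _ _ Finv Y w u) //; last first.
    by move=> b bw bw0; rewrite !inY ?setU11.
  by rewrite FY setUA setD1K // GA.
rewrite cardsX cards1 muln1 cardsU1 uF.
have := cardsC (supp G); rewrite -/Fr; have := minimal_card Finv Fsens minG.
by move: kT tm; move: #|Fr| #|supp G| #|G| #|T|; clear; lia.
Qed.

End Leafless.

(** * Isolated edges *)

Section IsolatedEdges.

Variables (T : finType) (F : {set {set T}} -> bool) (k : nat).
Hypotheses (Finv : invariant F) (Fsens : low_sens F k) (kT : 2 * k <= #|T|).
Implicit Types (G H K Z : {set {set T}}) (A B J : {set T}).
Implicit Types (a b u v w x y z : T) (e : {set T}) (p : T -> T).

Definition star z J : {set {set T}} := [set x -- z | x in J].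

Lemma in_star z J a b :
  (a -- b \in star z J) = (a \in J) && (b == z) || (b \in J) && (a == z).
Proof.
apply/imsetP/orP => [[x xJ /eqP]|[/andP[aJ /eqP->]|/andP[bJ /eqP->]]].
- rewrite edge_eq => /orP[/andP[/eqP-> ->]|/andP[-> /eqP->]]; rewrite xJ;
  by [left | right].
- by exists a.
- by exists b; rewrite // edgeC.
Qed.

Lemma starU1 z J x : star z (x |: J) = x -- z |: star z J.
Proof. by rewrite /star imsetU1. Qed.

Lemma star0 z : star z set0 = set0.
Proof. by rewrite /star imset0. Qed.

Definition paired Z B p :=
  forall x, x \in B -> [/\ p x \in B, p (p x) = x & nb Z x = [set p x]].

Lemma paired_neq Z B p x : paired Z B p -> x \in B -> p x != x.
Proof.
by move=> pB /pB[_ _ E]; have := set11 (p x); rewrite -E in_nb => /andP[].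
Qed.

Lemma paired_edge Z B p x b : paired Z B p -> x \in B -> b != x ->
  (x -- b \in Z) = (b == p x).
Proof. by move=> /[apply] -[_ _ E] bx; rewrite -in_set1 -E in_nb bx. Qed.

Lemma attach_all Z B p z x y : paired Z B p -> z \notin B -> x \in B ->
  y \in B -> F (x -- z |: Z) = F (y -- z |: Z).
Proof.
move=> pB zB xB yB; have [->//|yx] := eqVneq y x.
have zx : z != x by apply: contraNneq zB => ->.
have zy : z != y by apply: contraNneq zB => ->.
have [Ey|ypx] := eqVneq y (p x).
  apply: twin_swap => // b bx by1; rewrite !(paired_edge pB) // Ey.
  by have [_ -> _] := pB x xB; rewrite (negbTE bx) -Ey (negbTE by1).
have [pxB ppx _] := pB x xB; have [pyB ppy _] := pB y yB.
have pxx := paired_neq pB xB; have pyy := paired_neq pB yB.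
have ypy : p y != x by apply: contraNneq ypx => <-; rewrite ppy.
have pxpy : p x != p y by apply: contraNneq yx => E; rewrite -ppy -E ppx.
pose s := (tperm x y * tperm (p x) (p y))%g.
have sE a : a != x -> a != y -> a != p x -> a != p y -> s a = a.
  by move=> ax ay apx apy; rewrite permM !tpermD // eq_sym.
have sx : s x = y by rewrite permM tpermL tpermD // eq_sym.
have sy : s y = x by rewrite permM tpermR tpermD // eq_sym.
have spx : s (p x) = p y.
  by rewrite permM [tperm x y _]tpermD 1?eq_sym ?tpermL // eq_sym.
have spy : s (p y) = p x.
  by rewrite permM [tperm x y _]tpermD ?tpermR // eq_sym.
have sB a : a \in B -> s a \in B /\ p (s a) = s (p a).
  move=> aB; have [paB ppa _] := pB a aB.
  have [->|ax] := eqVneq a x; first by rewrite sx spx.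
  have [->|ay] := eqVneq a y; first by rewrite sy spy.
  have [->|apx] := eqVneq a (p x); first by rewrite ppx spx ppy sx.
  have [->|apy] := eqVneq a (p y); first by rewrite ppy spy ppx sy.
  rewrite (sE a) // (sE (p a)) //.
  - by apply: contraNneq apx => <-; rewrite ppa.
  - by apply: contraNneq apy => <-; rewrite ppa.
  - by apply: contraNneq ax => E; rewrite -ppa E ppx.
  - by apply: contraNneq ay => E; rewrite -ppa E ppy.
have sN a : a \notin B -> s a = a.
  by move=> aB; apply: sE; apply: contraNneq aB => ->.
have sZ a b : a \in B -> a != b -> (s a -- s b \in Z) = (a -- b \in Z).
  move=> aB ab; have [saB psa] := sB a aB.
  rewrite !(paired_edge pB) //; first by rewrite psa (inj_eq perm_inj).
    by rewrite eq_sym.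
  by rewrite (inj_eq perm_inj) eq_sym.
have Es : y -- z = s x -- s z by rewrite sx sN.
apply: (Finv (s := s)) => a b ab; rewrite !in_setU1 Es !edge_eq !(inj_eq perm_inj); congr (_ || _).
have [aB|aB] := boolP (a \in B); first exact: sZ.
have [bB|bB] := boolP (b \in B); last by rewrite !sN.
by rewrite (edgeC (s a)) (edgeC a) sZ // eq_sym.
Qed.

Lemma attach Z B p z x : paired Z B p -> z \notin B -> k <= #|B| -> x \in B ->
  F (x -- z |: Z) = F Z.
Proof.
move=> pB zB kB xB; apply/eqP/negPn/negP=> Fx; move: kB.
rewrite leqNgt => /negP; apply.
rewrite -[#|B|]muln1 -(cards1 z) -cardsX.
apply: (added_flips_lt Fsens (G := Z) (S := B)).
  by apply: setXS => //; rewrite sub1set in_setC.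
move=> y z'; rewrite in_setX in_set1 /= => /andP[yB /eqP->].
by rewrite (attach_all pB zB yB xB).
Qed.

Lemma attach_star Z B p z J : paired Z B p -> z \notin B -> J \subset B ->
  [disjoint J & p @: J] -> k + 2 * #|J| <= #|B| -> F (Z :|: star z J) = F Z.
Proof.
move=> pB zB; have [n] := ubnP #|J|; elim: n J => // n IH J Jn JB dJ kB.
have [->|/set0Pn[x xJ]] := eqVneq J set0; first by rewrite star0 setU0.
have xB := subsetP JB x xJ; pose J' := J :\ x.
have sJ' : J' \subset J by apply: subsetDl.
have cJ : #|J| = #|J'|.+1 by rewrite (cardsD1 x) xJ.
have dJ' : [disjoint J' & p @: J'].
  by apply: disjointW dJ; last apply: imsetS.
rewrite -(setD1K xJ) -/J' starU1 setUCA -(IH J') //; first last.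
- by move: kB; rewrite cJ; lia.
- exact: subset_trans JB.
- by rewrite cJ in Jn.
pose B' := B :\: (J' :|: p @: J').
have pJ y : y \in B -> (p y \in J') = (y \in p @: J').
  move=> yB; have [_ ppy _] := pB y yB; apply/idP/imsetP => [pyJ|[y' y'J E]].
    by exists (p y).
  by have [_ ppy' _] := pB y' (subsetP JB _ (subsetP sJ' _ y'J)); rewrite E ppy'.
apply: (@attach _ B' p).
- move=> y; rewrite in_setD in_setU negb_or => /andP[/andP[yJ ypJ] yB].
  have [pyB ppy Ny] := pB y yB; split=> //.
    by rewrite in_setD in_setU pyB pJ // (negbTE ypJ) -pJ // ppy (negbTE yJ).
  rewrite -Ny; apply/setP=> b; rewrite !in_nb in_setU in_star (negbTE yJ) /=.
  have -> : (y == z) = false by apply: contraNF zB => /eqP <-.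
  by rewrite andbF orbF.
- by rewrite in_setD (negbTE zB) andbF.
- rewrite cardsD; have := subset_leq_card (subsetIr B (J' :|: p @: J')).
  have := (leq_card_setU J' (p @: J')).1; have := leq_imset_card p J'.
  move: kB; rewrite cJ; set c1 := #|B|; set c2 := #|B :&: _|.
  set c3 := #|J' :|: _|; set c4 := #|p @: _|; set c5 := #|J'|.
  by move: c1 c2 c3 c4 c5; clear; lia.
rewrite in_setD xB andbT in_setU negb_or !inE eqxx /=.
by apply: contraFN (disjointFr dJ xJ); apply: subsetP; apply: imsetS.
Qed.

Lemma paired_half Z B p l : paired Z B p -> 2 * l <= #|B| ->
  exists J, [/\ J \subset B, #|J| = l & [disjoint J & p @: J]].
Proof.
move=> pB; elim: l => [|l IH] lB.
  by exists set0; rewrite sub0set cards0 disjoint_sym imset0 -setI_eq0 set0I.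
have [|J [JB cJ dJ]] := IH; first by move: lB; lia.
have [x xB xJ] : exists2 x, x \in B & x \notin J :|: p @: J.
  apply/subsetPn; apply: contraTN lB => /subset_leq_card.
  have := (leq_card_setU J (p @: J)).1; have := leq_imset_card p J; rewrite cJ.
  by move: #|B| #|_ :|: _| #|p @: _|; clear; lia.
move: xJ; rewrite in_setU negb_or => /andP[xJ xpJ].
exists (x |: J); split.
- by rewrite subUset sub1set xB.
- by rewrite cardsU1 xJ cJ.
have [pxB ppx _] := pB x xB; have pxx := paired_neq pB xB.
have pxJ : p x \notin J.
  by apply: contra xpJ => pxJ; apply/imsetP; exists (p x).
apply/pred0P=> y /=; apply/negP; rewrite imsetU1 !in_setU1.
case/andP=> /orP[/eqP->|yJ] /orP[/eqP E|ypJ].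
- by rewrite -E eqxx in pxx.
- by rewrite ypJ in xpJ.
- by rewrite -E yJ in pxJ.
- by have := disjointFr dJ yJ; rewrite ypJ.
Qed.

Definition isolated_edge_ends G := [set x in leaf G | leaves G x != set0].

Lemma card_isolated_edge_ends G : (forall e, e \in G -> #|e| = 2) ->
  4 * #|supp G| <= 6 * #|G| + #|isolated_edge_ends G|.
Proof.
move=> G2; set A := isolated_edge_ends G.
have AG : A \subset supp G.
  by apply: subset_trans (leaf_supp G); apply/subsetP=> x; rewrite inE => /andP[].
rewrite -(leq_add2r #|leaf G|) -{1}sum_leaves -(sum_mem_supp (leaf_supp G)) -(sum_mem_supp AG).
rewrite (_ : 6 = 3 * 2) // -mulnA -(handshake G2) mulnC -sum_nat_const big_distrr /=.
rewrite -!big_split /=; apply: leq_sum => x xG.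
have d1 : 0 < #|nb G x| by move: xG; rewrite inE card_gt0.
have cl : #|leaves G x| <= #|nb G x| by apply/subset_leq_card/subsetIl.
have lE : (x \in leaf G) = (#|nb G x| == 1) by rewrite inE.
have AE : (x \in A) = (#|nb G x| == 1) && (0 < #|leaves G x|).
  by rewrite inE lE card_gt0.
rewrite lE AE; move: d1 cl; move: #|nb G x| #|leaves G x|; clear => d l.
by case: eqP => /=; lia.
Qed.

Definition partner G x := odflt x [pick y in nb G x].

Lemma partner_nb G x : x \in leaf G -> nb G x = [set partner G x].
Proof.
move=> /leaf_nb[v E]; rewrite E /partner; case: pickP => [y|/(_ v)].
  by rewrite E inE => /eqP->.
by rewrite E set11.
Qed.

Lemma paired_ends G : paired G (isolated_edge_ends G) (partner G).
Proof.
move=> x; rewrite inE => /andP[xl /set0Pn[y]].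
rewrite in_setI partner_nb // in_set1 => /andP[/eqP-> yl].
have : x \in nb G (partner G x) by rewrite nbC partner_nb ?set11.
rewrite (partner_nb yl) in_set1 => /eqP E; split=> //.
rewrite inE yl; apply/set0Pn; exists x.
by rewrite in_setI xl andbT nbC partner_nb ?set11.
Qed.

(* [600 <= k] and [(|I|+2)(|I|+1) < 2 * k] give [12|I| + 8 <= k]. *)
Lemma no_isolated_edge G : 600 <= k -> minset F G -> isolated_edge_ends G = set0.
Proof.
move=> k600 minG; apply/eqP/negPn/negP=> /set0Pn[u uA].
have G2 := minimal_edge Finv minG.
pose A := isolated_edge_ends G; pose p := partner G.
have pA : paired G A p := @paired_ends G.
have [vA puv Nu] := pA u uA; set v := p u in vA puv Nu.
have [_ _ Nv] := pA v vA; rewrite puv in Nv.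
have vu : v != u := paired_neq pA uA.
have uv : u != v by rewrite eq_sym.
have uvG : u -- v \in G by rewrite (paired_edge pA).
have lsupp x : x \in A -> x \in supp G.
  by rewrite inE => /andP[xl _]; apply: subsetP xl; apply: leaf_supp.
pose H := G :\ (u -- v); pose I := ~: supp G.
have FH : F H = false by apply: minimal_del minG _ _.
have IG w : w \in I -> w \notin supp G by rewrite in_setC.
have inH w b : w != u -> w != v -> b != w -> (w -- b \in H) = (w -- b \in G).
  by move=> wu wv bw; rewrite in_setD1; edge_simp.
have uH : u \notin supp H by apply: leaf_del_supp.
have vH : v \notin supp H by rewrite /H edgeC; apply: leaf_del_supp.
have IH w : w \in I -> w \notin supp H.
  by move=> /IG; apply: contra; apply/subsetP/supp_sub/subD1set.
have i2 : #|I|.+2 * #|I|.+1 < 2 * k.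
  pose W := u |: (v |: I).
  have WH w : w \in W -> w \notin supp H.
    by rewrite !in_setU1 => /or3P[/eqP->|/eqP->|/IH].
  have cW : #|W| = #|I|.+2.
    rewrite !cardsU1 !in_setU1 (negbTE uv) !in_setC !lsupp //=.
  suff : 'C(#|W|, 2) < k.
    rewrite cW bin2 succnK; move: (#|I|.+2 * #|I|.+1); clear => i.
    by have := odd_double_half i; lia.
  rewrite -cards_draws; apply: (Fsens (G := H)) => e; rewrite inE => /andP[eW /eqP//].
  move=> /eqP/cards2P[x [y [xy Ee]]]; apply/orP; right; rewrite FH Ee.
  have xW : x \in W by apply: (subsetP eW); rewrite Ee set21.
  have yW : y \in W by apply: (subsetP eW); rewrite Ee set22.
  have yx : y != x by rewrite eq_sym.
  have F1 w : w \in W -> w != u -> F (u -- w |: H).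
    move=> wW wu; have uw : u != w by rewrite eq_sym.
    by rewrite edgeC (iso_swap Finv (WH w wW) vH) // edgeC setD1K // (minimal_true minG).
  have [E|yu] := eqVneq y u.
    by rewrite E edgeC F1 // -E.
  by rewrite (iso_swap Finv (WH x xW) uH) ?F1.
have cA := card_isolated_edge_ends G2; rewrite -/A in cA.
have cI := cardsC (supp G); rewrite -/I in cI.
have cG := minimal_card Finv Fsens minG.
have cS := card_supp_le Finv minG.
pose l := (k %/ 3).+1.
pose B := A :\ u :\ v.
have cB : #|B| + 2 = #|A|.
  by rewrite (cardsD1 u A) uA (cardsD1 v (A :\ u)) in_setD1 vu vA addnC.
have kB : k + 2 * l <= #|B|.
  have l3 : 3 * l <= k + 3 by rewrite /l; clear; lia.
  move: i2 cA cI cG cS cB kT l3 k600.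
  move: #|I| #|A| #|B| #|supp G| #|G| #|T| (l); clear; nia.
have k3l : k <= 3 * l by rewrite /l; clear; lia.
have Ii : 2 <= #|I| by move: cI cG cS kT; move: #|I| #|supp G| #|G| #|T|; clear; lia.
have inB x : x \in B = [&& x != v, x != u & x \in A] by rewrite !in_setD1.
have pB : paired G B p.
  move=> x; rewrite inB => /and3P[xv xu xA]; have [pxA ppx Nx] := pA x xA.
  split=> //; rewrite inB pxA andbT; apply/andP; split.
    by apply: contraNneq xu => E; rewrite -ppx E puv.
  by apply: contraNneq xv => E; rewrite -ppx E.
have uB : u \notin B by rewrite inB eqxx andbF.
have vB : v \notin B by rewrite inB eqxx.
have pBH : paired H B p.
  move=> x xB; have [pxB ppx Nx] := pB x xB; split=> //.
  move: xB; rewrite inB => /and3P[xv xu xA].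
  by rewrite -Nx; apply/setP=> b; rewrite !in_nb; case: eqVneq => //= bx; rewrite inH.
have [|J [JB cJ dJ]] := paired_half pB (l := l).
  by apply: leq_trans kB; rewrite leq_addl.
pose Y := H :|: star u J.
have FY : F Y = false by rewrite (attach_star pBH) ?cJ.
have JN x : x \in J -> [/\ x \in B, x != u & x != v].
  by move=> /(subsetP JB) xB; split=> //; apply: contraTneq xB => ->.
have suppY w : w \in v |: I -> w \notin supp Y.
  move=> wI; have [wH wu wJ] : [/\ w \notin supp H, w != u & w \notin J].
    move: wI; rewrite in_setU1 => /orP[/eqP->|wI].
      by split=> //; apply: contra vB => /(subsetP JB).
    split; first exact: IH.
      by apply: contraTneq wI => ->; rewrite in_setC lsupp.
    apply: contraTN wI => /(subsetP JB); rewrite inB => /and3P[_ _ /lsupp].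
    by rewrite in_setC negbK.
  rewrite inE negbK -subset0; apply/subsetP=> b; rewrite in_nb in_setU => /andP[bw].
  by rewrite notin_supp //= in_star (negbTE wJ) (negbTE wu) andbF.
have flipY x : x \in J -> F (p x -- v |: Y).
  move=> xJ; have [xB xu xv] := JN x xJ.
  have [yB py Nx] := pB x xB; set y := p x in yB py Nx.
  have yx : y != x := paired_neq pB xB.
  have yu : y != u by apply: contraTneq yB => ->.
  have yv : y != v by apply: contraTneq yB => ->.
  pose G1 := y -- v |: G; pose J' := J :\ x.
  have F1 : F G1.
    rewrite (attach pB) ?(minimal_true minG) //.
    by apply: leq_trans kB; rewrite leq_addr.
  pose B1 := B :\ x :\ y.
  have inB1 b : b \in B1 = [&& b != y, b != x & b \in B] by rewrite !in_setD1.
  have pB1 : paired G1 B1 p.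
    move=> b; rewrite inB1 => /and3P[bY bx bB]; have [pbB ppb Nb] := pB b bB.
    split=> //.
      rewrite inB1 pbB andbT; apply/andP; split.
        by apply: contraNneq bx => E; rewrite -ppb E py.
      by apply: contraNneq bY => E; rewrite -ppb E.
    rewrite -Nb; apply/setP=> c; rewrite !in_nb in_setU1 edge_eq.
    have bv : b != v by apply: contraTneq bB => ->.
    by rewrite (negbTE bY) (negbTE bv).
  have yJ : y \notin J.
    apply/negP=> yJ; have := disjointFr dJ yJ; rewrite -/y => /negP; apply.
    by apply/imsetP; exists x.
  have F2 : F (G1 :|: star u J').
    rewrite (attach_star pB1) ?F1 //.
    - by rewrite inB1 (negbTE uB) !andbF.
    - apply/subsetP=> b; rewrite in_setD1 inB1 => /andP[bx bJ].
      by rewrite bx (subsetP JB) // !andbT; apply: contraNneq yJ => <-.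
    - by apply: disjointW dJ; [apply: subsetDl | apply/imsetS/subsetDl].
    - have : #|B1| + 2 = #|B|.
        by rewrite (cardsD1 x B) xB (cardsD1 y (B :\ x)) in_setD1 yx yB addnC.
      have : #|J'| + 1 = l by rewrite -cJ (cardsD1 x J) xJ addnC.
      by move: kB; move: #|B1| #|J'| #|B| (l); clear; lia.
  suff <- : F (G1 :|: star u J') = F (y -- v |: Y) by [].
  apply: (F_swap Finv (u := v) (w := x)).
  - move=> b bv bx; rewrite in_setU1 (notin_supp (suppY v (setU11 _ _))) //.
    rewrite !in_setU !in_set1 !edge_eq !in_star in_setD1 (paired_edge pB) // -/y.
    by edge_simp.
  - move=> b bv bx; rewrite !in_setU !in_set1 !edge_eq !in_star !in_setD1.
    have vJ : v \notin J by apply: contra vB => /(subsetP JB).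
    rewrite (paired_edge pB) // -/y (paired_edge pA) // puv (negbTE vJ) xJ.
    by edge_simp; rewrite orbC.
  - move=> a b ab av ax bv bx; rewrite !in_setU !in_set1 !edge_eq !in_star !in_setD1.
    by edge_simp.
  have vJ : v \notin J by apply: contra vB => /(subsetP JB).
  rewrite !in_setU !in_set1 !edge_eq !in_star !in_setD1.
  by rewrite (paired_edge pA) // puv (negbTE vJ); edge_simp.
have : #|setX (p @: J) (v |: I)| < k.
  apply: (added_flips_lt Fsens (G := Y) (S := p @: J)).
    apply: setXS => //; apply/subsetP=> w wI; rewrite in_setC; apply/imsetP=> -[x xJ Ew].
    have [/pB[yB _ _] _ _] := JN x xJ; rewrite -Ew in yB.
    move: wI; rewrite in_setU1 => /orP[/eqP E|]; first by rewrite E (negbTE vB) in yB.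
    by rewrite in_setC lsupp //; move: yB; rewrite inB => /and3P[].
  move=> y w; rewrite in_setX /= => /andP[/imsetP[x xJ ->] wI].
  have [xB xu xv] := JN x xJ; have [yB _ _] := pB x xB.
  have yI : p x \notin v |: I.
    rewrite in_setU1 in_setC lsupp ?orbF; last by move: yB; rewrite inB => /and3P[].
    by apply: contraNneq vB => <-.
  rewrite edgeC (iso_swap Finv (y' := v)) ?suppY ?setU11 //.
  - by rewrite edgeC flipY // FY.
  - by apply: contraNneq yI => ->.
  - by apply: contraNneq yI => ->; rewrite setU11.
rewrite cardsX cardsU1 in_setC lsupp //= card_in_imset ?cJ.
  move: k3l Ii; move: #|I| (l); clear; nia.
move=> x x' /JN[xB _ _] /JN[x'B _ _] E.
by have [_ <- _] := pB x xB; rewrite E; have [_ -> _] := pB x' x'B.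
Qed.

End IsolatedEdges.

(** * Leafy minimal graphs *)

Section Leaves.

Variable T : finType.
Implicit Types (G K Z : {set {set T}}) (X Y : {set T}).
Implicit Types (a b u v w x y z : T) (e : {set T}).

Definition hang G X := [set u in leaf G | partner G u \in X].

Lemma in_hang G X u :
  (u \in hang G X) = (u \in leaf G) && (partner G u \in X).
Proof. by rewrite in_set. Qed.

Lemma hang1 G x : hang G [set x] = leaves G x.
Proof.
apply/setP=> u; rewrite !inE; case: eqP => [u1|]; rewrite ?andbF //= ?andbT.
have ul : u \in leaf G by rewrite inE u1.
have := nbC G u x; rewrite partner_nb // in_set1 in_nb => <-.
by rewrite eq_sym.
Qed.

Lemma card_hang G X : #|hang G X| = \sum_(x in X) #|leaves G x|.
Proof.
rewrite -sum1_card (partition_big (partner G) (mem X)) /=; last first.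
  by move=> u; rewrite in_hang => /andP[].
apply: eq_bigr => x xX; rewrite -hang1 -sum1_card; apply: eq_bigl => u.
by rewrite !in_hang in_set1 -andbA; case: eqP => [->|]; rewrite ?xX ?andbF.
Qed.

Lemma hangS G X Y : X \subset Y -> hang G X \subset hang G Y.
Proof.
by move=> XY; apply/subsetP=> u; rewrite !in_hang => /andP[-> /(subsetP XY)].
Qed.

Lemma in_leaves G x y : (y \in leaves G x) = (y \in leaf G) && (partner G y == x).
Proof. by rewrite -hang1 in_hang in_set1. Qed.

Definition rich_parents G := [set x | 2 <= #|leaves G x|].

End Leaves.

Section LeafyMinimal.

Variables (T : finType) (F : {set {set T}} -> bool) (k : nat).
Hypotheses (Finv : invariant F) (Fsens : low_sens F k) (kT : 2 * k <= #|T|).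
Hypothesis k600 : 600 <= k.
Implicit Types (a b u v w x y z : T) (e : {set T}).

Variable G : {set {set T}}.
Hypothesis minG : minset F G.

Lemma card_supp_32 : 2 * #|supp G| <= 3 * #|G|.
Proof.
have := card_isolated_edge_ends (minimal_edge Finv minG).
rewrite (no_isolated_edge Finv Fsens kT k600 minG) cards0.
by move: #|supp G| #|G|; clear; lia.
Qed.

Lemma card_iso_ge : k + 3 <= 2 * #|~: supp G|.
Proof.
have := cardsC (supp G); have := minimal_card Finv Fsens minG.
have := card_supp_32; move: kT.
by move: #|supp G| #|~: supp G| #|G| #|T|; clear; lia.
Qed.

Lemma leaf_nbN u v : u \in leaf G -> v \in nb G u -> v \notin leaf G.
Proof.
move=> ul vu; apply/negP=> vl.
have : u \in isolated_edge_ends G.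
  by rewrite in_set ul; apply/set0Pn; exists v; rewrite in_setI vu.
by rewrite (no_isolated_edge Finv Fsens kT k600 minG) in_set0.
Qed.

Lemma leaves0 u : u \in leaf G -> leaves G u = set0.
Proof.
move=> ul; apply/setP=> v; rewrite in_setI in_set0; apply/negP=> /andP[vu].
exact/negP/(leaf_nbN ul).
Qed.

Lemma parent_degree u v : u \in leaf G -> v \in nb G u -> 2 < #|nb G v|.
Proof.
move=> ul vu; rewrite ltnNge; apply/negP=> dv.
have Nu := leaf_nbE ul vu.
have /andP[vNu uvG] : (v != u) && (u -- v \in G) by rewrite -in_nb.
have uv : u \in nb G v by rewrite nbC.
have {dv} d2 : #|nb G v| = 2.
  apply/eqP; rewrite eqn_leq dv /= ltn_neqAle card_gt0 eq_sym.
  by have := leaf_nbN ul vu; rewrite inE => ->; apply/set0Pn; exists u.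
have [z Nv] : exists z, nb G v :\ u = [set z].
  by apply/cards1P; move: d2; rewrite (cardsD1 u) uv add1n => -[->].
have : z \in nb G v :\ u by rewrite Nv set11.
rewrite in_setD1 in_nb => /and3P[zu zv vzG].
pose H := G :\ (u -- v); pose I := ~: supp G; pose W := u |: I.
have uS := subsetP (leaf_supp G) u ul.
have vS : v \in supp G by rewrite (in_supp vNu) // edgeC.
have zS : z \in supp G by rewrite (in_supp zv) // edgeC.
have FG := minimal_true minG.
have FH : F H = false by apply: (minimal_del minG).
have uH : u \notin supp H by apply: leaf_del_supp.
have WH w : w \in W -> w \notin supp H.
  rewrite in_setU1 => /orP[/eqP-> //|]; rewrite in_setC; apply: contra.
  exact/subsetP/supp_sub/subD1set.
have notW x : x \in supp G -> x != u -> x \notin W.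
  by move=> xS xu; rewrite in_setU1 (negbTE xu) in_setC xS.
have vW := notW v vS vNu; have zW := notW z zS zu.
have neqW x w : x \notin W -> w \in W -> x != w.
  by move=> xW wW; apply: contraNneq xW => ->.
have cW : #|W| = #|I|.+1 by rewrite cardsU1 in_setC uS.
have i2 := card_iso_ge; rewrite -/I in i2.
have uW : u \in W by apply: setU11.
have [w0 w0I] : exists w0, w0 \in I.
  by apply/set0Pn; rewrite -card_gt0; move: i2; move: #|I|; clear; lia.
have w0W : w0 \in W by rewrite in_setU1 w0I orbT.
have Fz : F (w0 -- z |: H) = false.
  apply/negP=> Fz.
  have : #|setX W [set v; z]| < k.
    apply: (added_flips_lt Fsens (G := H) (S := W)).
      by apply: setXS => //; rewrite subUset !sub1set !in_setC vW.
    move=> w x; rewrite in_setX in_set2 /= => /andP[wW /orP[]/eqP->]; rewrite FH.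
      by rewrite (iso_swap Finv (WH w wW) uH) ?neqW // setD1K ?FG.
    by rewrite (iso_swap Finv (WH w wW) (WH w0 w0W)) ?neqW // Fz.
  rewrite cardsX cards2 eq_sym zv cW.
  by move: i2; move: #|I|; clear; lia.
have w0u : w0 != u by apply: contraTneq w0I => ->; rewrite in_setC uS.
have vw0 := neqW v w0 vW w0W; have zw0 := neqW z w0 zW w0W.
have w0H := WH w0 w0W.
pose Y := w0 -- z |: H.
have WY w : w \in W -> w != w0 -> w \notin supp Y.
  move=> wW ww0; rewrite inE negbK -subset0; apply/subsetP=> b.
  rewrite in_nb in_setU1 => /andP[bw]; rewrite (notin_supp (WH w wW)) //.
  have := neqW z w zW wW => zw.
  by edge_simp.
have twY : twin Y v w0.
  move=> b bv bw0; rewrite !in_setU1 (notin_supp w0H) // orbF.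
  rewrite in_setD1.
  have -> : (v -- b \in G) = (b == u) || (b == z).
    have := in_setD1 b (nb G v) u; rewrite Nv in_set1 in_nb bv /= => ->.
    by case: eqVneq => // ->; rewrite edgeC uvG.
  by edge_simp; case: eqVneq => // ->; rewrite (eq_sym u) (negbTE zu).
have : #|setX (W :\ w0) [set v; w0]| < k.
  apply: (added_flips_lt Fsens (G := Y) (S := W :\ w0)).
    apply: setXS => //; rewrite subUset !sub1set !in_setC in_setD1 (negbTE vW) andbF.
    by rewrite !inE eqxx.
  have FY w : w \in W -> w != w0 -> F (v -- w |: Y).
    move=> wW ww0; have vw := neqW v w vW wW.
    rewrite edgeC (iso_swap Finv (WY w wW ww0) (WY u uW _)) // 1?eq_sym //.
    rewrite setUCA setD1K //; apply: (minimal_pendant Finv Fsens minG kT) => //.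
    by rewrite -in_setC.
  move=> w x; rewrite in_setX in_setD1 in_set2 /= => /andP[/andP[ww0 wW]].
  have vw := neqW v w vW wW.
  rewrite Fz edgeC => /orP[]/eqP->; first by rewrite FY.
  by rewrite -(twin_swap Finv twY) ?FY // eq_sym.
rewrite cardsX cards2 vw0.
have := cardsD1 w0 W; rewrite w0W cW add1n => -[<-].
by move: i2; move: #|I|; clear; lia.
Qed.

Lemma leaves_degree x : x \in supp G ->
  [/\ 0 < #|nb G x|, #|leaves G x| <= #|nb G x|,
      (x \in leaf G) = (#|nb G x| == 1), x \in leaf G -> #|leaves G x| = 0 &
      0 < #|leaves G x| -> 2 < #|nb G x|].
Proof.
rewrite inE -card_gt0 => d0; split=> //.
- exact/subset_leq_card/subsetIl.
- by rewrite inE.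
- by move/leaves0->; rewrite cards0.
rewrite card_gt0 => /set0Pn[u]; rewrite in_setI => /andP[ux ul].
by apply: (parent_degree ul); rewrite nbC.
Qed.

Lemma card_supp_43 : 3 * #|supp G| <= 4 * #|G|.
Proof.
rewrite -(leq_add2r #|leaf G|) -{1}sum_leaves -(sum_mem_supp (leaf_supp G)).
rewrite (_ : 4 = 2 * 2) // -mulnA -(handshake (minimal_edge Finv minG)).
rewrite mulnC -sum_nat_const big_distrr /= -!big_split /=; apply: leq_sum => x xG.
have [d0 cl lE l0 l3] := leaves_degree xG; move: l0 l3 d0 cl; rewrite lE.
by move: #|nb G x| #|leaves G x|; clear => d l; case: eqP => /=; lia.
Qed.

Lemma card_rich_parents : #|supp G| <= #|G| + #|rich_parents G|.
Proof.
have PG : rich_parents G \subset supp G.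
  apply/subsetP=> x; rewrite !inE => lx; rewrite -card_gt0.
  by apply: leq_trans (subset_leq_card (subsetIl _ _)); apply: leq_trans lx.
suff : 2 * #|supp G| + #|leaf G| <=
       2 * #|G| + 2 * #|rich_parents G| + #|leaf G|.
  by move: #|supp G| #|G| #|rich_parents G| #|leaf G|; clear; lia.
rewrite -{1}sum_leaves -(sum_mem_supp (leaf_supp G)) -(sum_mem_supp PG).
rewrite -(handshake (minimal_edge Finv minG)).
rewrite mulnC -sum_nat_const big_distrr /= -!big_split /=; apply: leq_sum => x xG.
have [d0 cl lE l0 l3] := leaves_degree xG; move: l0 l3 d0 cl.
rewrite lE in_set; move: #|nb G x| #|leaves G x|; clear => d l.
by case: eqP => /=; case: leqP => /=; lia.
Qed.

End LeafyMinimal.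

Definition inner (T : finType) (G : {set {set T}}) :=
  [set e in G | [disjoint e & leaf G]].

Definition pend (T : finType) (w : T -> T) (X : {set T}) : {set {set T}} :=
  [set w x -- x | x in X].

Section Pendants.

Variables (T : finType) (F : {set {set T}} -> bool) (k : nat).
Hypotheses (Finv : invariant F) (Fsens : low_sens F k) (kT : 2 * k <= #|T|).
Hypothesis k600 : 600 <= k.
Implicit Types (a b u v x y z : T) (e : {set T}) (Y : {set T}).

Variable G : {set {set T}}.
Hypotheses (minG : minset F G)
  (innerG : forall K, minset F K -> leaf K != set0 -> #|inner G| <= #|inner K|).

Variables (w : T -> T) (X : {set T}).
Hypotheses (XP : X \subset rich_parents G)
  (wI : forall x, x \in X -> w x \notin supp G) (winj : {in X &, injective w}).

Let I := ~: supp G.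

Lemma in_pend Y a b :
  (a -- b \in pend w Y) = (b \in Y) && (a == w b) || (a \in Y) && (b == w a).
Proof.
apply/imsetP/orP => [[x xY /eqP]|[/andP[bY /eqP->]|/andP[aY /eqP->]]].
- by rewrite edge_eq => /orP[]/andP[/eqP-> /eqP->]; rewrite xY eqxx; [left | right].
- by exists b.
- by exists a; rewrite // edgeC.
Qed.

Lemma pendU1 Y x : pend w (x |: Y) = w x -- x |: pend w Y.
Proof. by rewrite /pend imsetU1. Qed.

Lemma rich_supp x : x \in X -> x \in supp G.
Proof.
move=> /(subsetP XP); rewrite in_set => lx; rewrite inE -card_gt0.
by apply: leq_trans (subset_leq_card (subsetIl _ _)); apply: leq_trans lx.
Qed.

Lemma rich_leaf x : x \in rich_parents G -> x \notin leaf G.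
Proof.
rewrite in_set; apply: contraTN => xl.
by rewrite (leaves0 Finv Fsens kT k600 minG xl) cards0.
Qed.

Lemma neq_w x y : x \in X -> y \in supp G -> (y == w x) = false.
Proof. by move=> xX; apply: contraTF => /eqP->; apply: wI. Qed.

Lemma pend_supp Y a b : Y \subset X -> a \in supp G -> b \in supp G ->
  (a -- b \in pend w Y) = false.
Proof.
move=> YX aS bS; rewrite in_pend; apply/negbTE/negP.
by case/orP=> /andP[/(subsetP YX) zX]; rewrite neq_w.
Qed.

Lemma pend_leaf Y u b : Y \subset X -> u \in leaf G -> (u -- b \in pend w Y) = false.
Proof.
move=> YX ul; have uS := subsetP (leaf_supp G) u ul.
rewrite in_pend; apply/negbTE/negP=> /orP[/andP[/(subsetP YX) bX]|/andP[uY _]].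
  by rewrite neq_w.
by have := rich_leaf (subsetP XP u (subsetP YX u uY)); rewrite ul.
Qed.

Lemma pend_iso Y a b : Y \subset X -> a \notin supp G -> b != a ->
  (a -- b \in G :|: pend w Y) = (b \in Y) && (a == w b).
Proof.
move=> YX aS ba; rewrite in_setU (notin_supp aS) // in_pend orbC.
case aY: (a \in Y); rewrite ?orbF //.
by rewrite (rich_supp (subsetP YX a aY)) in aS.
Qed.

Lemma pend_notin Y e : Y \subset X -> e \in G -> e \notin pend w Y.
Proof.
move=> YX eG; have [x [y [xy Ee]]] := minimal_edgeP Finv minG eG.
rewrite Ee pend_supp //; first by rewrite (in_supp xy) -?Ee.
by rewrite (@in_supp _ _ _ x) 1?eq_sym // edgeC -Ee.
Qed.

Lemma pend_del Y e : Y \subset X -> e \in G ->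
  (G :|: pend w Y) :\ e = (G :\ e) :|: pend w Y.
Proof. by move=> YX eG; rewrite setDUl (setD1_notin (pend_notin YX eG)). Qed.

Lemma iso_pend Y y : Y \subset X -> y \in I :\: w @: Y ->
  y \notin supp (G :|: pend w Y).
Proof.
move=> YX; rewrite in_setD in_setC => /andP[ywY yS].
rewrite inE negbK -subset0; apply/subsetP=> b; rewrite in_nb => /andP[bs].
rewrite pend_iso // => /andP[bY /eqP E]; case/negP: ywY.
by apply/imsetP; exists b.
Qed.

Lemma iso_pend_del Y y e : Y \subset X -> y \in I :\: w @: Y ->
  y \notin supp ((G :\ e) :|: pend w Y).
Proof.
move=> YX /(iso_pend YX); apply: contra; apply/subsetP/supp_sub.
by rewrite setSU ?subD1set.
Qed.

Lemma leaf_pend_del Y u v : Y \subset X -> u \in leaf G -> v \in nb G u ->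
  u \notin supp ((G :\ (u -- v)) :|: pend w Y).
Proof.
move=> YX ul vu; have uH := leaf_del_supp (leaf_nbE ul vu).
rewrite inE negbK -subset0; apply/subsetP=> b; rewrite in_nb => /andP[bs].
by rewrite in_setU (notin_supp uH) // pend_leaf.
Qed.

(* A minimal graph inside [G - e + pendants] would be leafy with fewer inner
   edges than [G]. *)
Lemma inner_del Y e : Y \subset X -> e \in inner G ->
  F ((G :\ e) :|: pend w Y) = false.
Proof.
move=> YX; rewrite in_set => /andP[eG eN]; apply/negP=> FZ.
have [K minK KZ] := minset_exists FZ.
have [e' e'K e'P] := minimal_meets minG minK eG KZ.
have wleaf x : x \in Y -> w x -- x \in K -> w x \in leaf K.
  move=> xY wxK; rewrite inE; apply/cards1P; exists x; apply/setP=> b.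
  have wS := wI (subsetP YX x xY).
  rewrite in_nb in_set1; apply/andP/eqP => [[bw /(subsetP KZ)]|->].
    rewrite in_setU in_setD1 (notin_supp wS) // andbF /= => bP.
    have := pend_iso YX wS bw; rewrite in_setU bP orbT => /esym/andP[bY /eqP E].
    by apply/esym/(winj (subsetP YX x xY) (subsetP YX b bY)).
  by rewrite wxK; split=> //; rewrite neq_w ?(subsetP YX) // rich_supp ?(subsetP YX).
have /imsetP[x xY Ee'] := e'P.
have lK : leaf K != set0.
  by apply/set0Pn; exists (w x); apply: wleaf; rewrite -?Ee'.
have := innerG minK lK; rewrite leqNgt => /negP; apply.
apply: (@leq_ltn_trans #|inner G :\ e|); last first.
  by rewrite [X in _ < X](cardsD1 e) in_set eG eN.
apply/subset_leq_card/subsetP=> f; rewrite in_set => /andP[fK fN].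
have fG : f \in G :\ e.
  have := subsetP KZ f fK; rewrite in_setU => /orP[//|/imsetP[y yY Ef]].
  have wl : w y \in leaf K by apply: wleaf; rewrite -?Ef.
  by have := disjointFl fN wl; rewrite Ef set21.
move: fG; rewrite in_setD1 => /andP[fe fG].
rewrite in_setD1 fe in_set fG; apply/pred0P=> y /=; apply/negP=> /andP[yf yl].
have := disjointFr fN yf; rewrite inE => /negP; apply.
have [a [b [ab Ef]]] := minimal_edgeP Finv minG fG.
have [z [zy Efz]] : exists z, z != y /\ f = y -- z.
  move: yf; rewrite Ef in_set2 => /orP[]/eqP->; first by exists b; rewrite eq_sym.
  by exists a; rewrite edgeC.
apply/cards1P; exists z; apply/setP=> c; rewrite in_nb in_set1.
apply/andP/eqP => [[cy /(subsetP KZ)]|->]; last by rewrite -Efz.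
rewrite in_setU in_setD1 pend_leaf // orbF => /andP[_ ycG].
have [z' Nz'] := leaf_nb yl.
have : c \in nb G y by rewrite in_nb cy.
have : z \in nb G y by rewrite in_nb zy -Efz.
by rewrite Nz' !in_set1 => /eqP-> /eqP->.
Qed.

Definition hang_edges Y : {set {set T}} :=
  [set u -- partner G u | u in hang G Y].

Lemma card_hang_edges Y : #|G| - #|hang G Y| <= #|G :\: hang_edges Y|.
Proof.
rewrite cardsD leq_sub2l //.
by apply: leq_trans (subset_leq_card (subsetIr _ _)) (leq_imset_card _ _).
Qed.

Lemma del_flips Y :
    Y \subset X ->
    (forall u v, u \in leaf G -> v \in nb G u -> v \notin Y ->
      F ((G :\ (u -- v)) :|: pend w Y) = false) ->
  forall e, e \in G :\: hang_edges Y -> F ((G :|: pend w Y) :\ e) = false.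
Proof.
move=> YX FY e; rewrite in_setD => /andP[eH eG]; rewrite pend_del //.
have [eN|] := boolP [disjoint e & leaf G].
  by apply: inner_del; rewrite // in_set eG.
case/pred0Pn=> u /= /andP[ue ul]; have Nu := partner_nb ul.
have Ee : e = u -- partner G u.
  have [a [b [ab Ee]]] := minimal_edgeP Finv minG eG.
  move: ue; rewrite Ee in_set2 => /orP[/eqP E|/eqP E]; subst u.
    have : b \in nb G a by rewrite in_nb eq_sym ab -Ee.
    by rewrite Nu in_set1 => /eqP <-.
  have : a \in nb G b by rewrite in_nb ab edgeC -Ee.
  by rewrite Nu in_set1 edgeC => /eqP <-.
rewrite Ee; apply: FY; rewrite ?Nu ?set11 //; apply: contra eH => pY.
by rewrite Ee; apply/imsetP; exists u => //; rewrite in_hang ul.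
Qed.

Lemma nb_leaf_supp u v : u \in leaf G -> v \in nb G u ->
  [/\ u \in supp G, v \in supp G, v != u, v \notin leaf G & u -- v \in G].
Proof.
move=> ul vu; have := vu; rewrite in_nb => /andP[vNu uvG]; split=> //.
- exact: subsetP (leaf_supp G) u ul.
- by rewrite (in_supp vNu) // edgeC.
- exact: (leaf_nbN Finv Fsens kT k600 minG ul).
Qed.

Hypotheses
  (budget1 : forall Y, Y \proper X -> k + #|Y| + #|hang G Y| <= #|I| + #|G|)
  (budget2 : forall Y, Y \proper X -> k + 2 * #|Y| <= 2 * #|I| + 2).

Lemma card_iso_w Y : Y \subset X -> #|I :\: w @: Y| = #|I| - #|Y|.
Proof.
move=> YX; rewrite cardsD (setIidPr _).
  by rewrite card_in_imset // => x y /(subsetP YX) xX /(subsetP YX) yX; apply: winj.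
by apply/subsetP=> y /imsetP[x /(subsetP YX) xX ->]; rewrite in_setC wI.
Qed.

Lemma pend_values Y : Y \subset X ->
  F (G :|: pend w Y) /\
  forall u v, u \in leaf G -> v \in nb G u -> v \notin Y ->
    F ((G :\ (u -- v)) :|: pend w Y) = false.
Proof.
have [n] := ubnP #|Y|; elim: n Y => // n IH Y Yn YX.
have [->|/set0Pn[x xY]] := eqVneq Y set0.
  rewrite /pend imset0 setU0 (minimal_true minG); split=> // u v ul vu _.
  rewrite setU0; apply: (minimal_del minG).
  by have [] := nb_leaf_supp ul vu.
have cY := cardsD1 x Y; rewrite xY add1n in cY.
pose Y' := Y :\ x.
have Y'p : Y' \proper X by apply: proper_sub_trans YX; apply: properD1.
have Y'X := proper_sub Y'p.
have EY : Y = x |: Y' by rewrite setD1K.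
have xY' : x \notin Y' by rewrite in_setD1 eqxx.
have [|F1 F0] := IH Y' _ Y'X; first by rewrite -cY in Yn *.
have xX := subsetP YX x xY; have xS := rich_supp xX.
have EP : pend w Y = w x -- x |: pend w Y' by rewrite EY pendU1.
have wxI : w x \in I :\: w @: Y'.
  rewrite in_setD in_setC wI // andbT; apply/imsetP=> -[y yY' E].
  by move: xY'; rewrite (winj xX (subsetP Y'X y yY') E) yY'.
have xI y : y \in I :\: w @: Y' -> x != y.
  by rewrite in_setD in_setC => /andP[_]; apply: contraNneq => <-.
have cI := card_iso_w Y'X.
split.
  apply/negPn/negP=> /negbTE FY.
  have : #|G :\: hang_edges Y'| + #|setX (I :\: w @: Y') [set x]| < k.
    apply: (flips_lt Fsens (G := G :|: pend w Y') (S := I)).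
    - by move=> e; rewrite in_setD => /andP[_ /(minimal_edge Finv minG)].
    - by move=> e /(del_flips Y'X F0)->; rewrite F1.
    - by apply: setXS; [apply: subsetDl | rewrite sub1set !in_setC negbK].
    move=> y z; rewrite in_setX in_set1 /= => /andP[yI /eqP->].
    rewrite (iso_swap Finv (iso_pend Y'X yI) (iso_pend Y'X wxI)) ?xI //.
    by rewrite setUCA -EP FY F1.
  rewrite cardsX cards1 muln1 cI; have := card_hang_edges Y'.
  have := budget1 Y'p; have := budget2 Y'p.
  have : #|hang G Y'| <= #|leaf G|.
    by apply/subset_leq_card/subsetP=> u; rewrite in_hang => /andP[].
  move: #|hang G Y'| #|Y'| #|I| #|G| #|G :\: _|.
  by clear; lia.
move=> u v ul vu vY; have [uS vS vNu vl uvG] := nb_leaf_supp ul vu.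
have vY' : v \notin Y' by apply: contra vY; apply: subsetP; apply: subsetDl.
have vx : v != x by apply: contraNneq vY => ->.
apply/negP=> FY; pose Z := (G :\ (u -- v)) :|: pend w Y'.
pose W := u |: (I :\: w @: Y').
have WZ y : y \in W -> y \notin supp Z.
  rewrite in_setU1 => /orP[/eqP->|yI]; first exact: leaf_pend_del.
  exact: iso_pend_del.
have uW : u \in W by apply: setU11.
have wW : w x \in W by rewrite in_setU1 wxI orbT.
have xl := rich_leaf (subsetP XP x xX).
have xW y : y \in W -> x != y.
  rewrite in_setU1 => /orP[/eqP->|/xI//].
  by apply: contraNneq xl => ->.
have vI : v \notin W.
  by rewrite in_setU1 (negbTE vNu) in_setD in_setC vS andbF.
have vW y : y \in W -> v != y by apply: contraTneq => <-.
have : #|setX W [set x; v]| < k.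
  apply: (added_flips_lt Fsens (G := Z) (S := W)).
    apply: setXS => //; rewrite subUset !sub1set !in_setC vI andbT.
    by apply/negP=> /xW; rewrite eqxx.
  move=> y z; rewrite in_setX in_set2 /= => /andP[yW /orP[]/eqP->];
    rewrite F0 //.
    rewrite (iso_swap Finv (WZ y yW) (WZ _ wW)) ?xW //.
    by rewrite setUCA -EP FY.
  rewrite (iso_swap Finv (WZ y yW) (WZ _ uW)) ?vW //.
  by rewrite setUA setD1K // F1.
rewrite cardsX cards2 eq_sym vx cardsU1 cI in_setD in_setC uS andbF /=.
by have := budget2 Y'p; move: #|Y'| #|I|; clear; lia.
Qed.

Lemma pend_delK x : x \in X -> pend w X = w x -- x |: pend w (X :\ x).
Proof. by move=> xX; rewrite -pendU1 setD1K. Qed.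

Lemma new_edge_swap Y u v x : Y \subset X -> x \in X -> x \notin Y ->
  u \in leaf G -> v \in nb G u -> v \notin X ->
  F (w x -- v |: ((G :\ (u -- v)) :|: (w x -- x |: pend w Y))) =
  F (u -- x |: (G :|: pend w Y)).
Proof.
move=> YX xX xY ul vu vX; have [uS vS vNu vl uvG] := nb_leaf_supp ul vu.
have xS := rich_supp xX; have wS := wI xX; have xl := rich_leaf (subsetP XP x xX).
have wu : w x != u by rewrite eq_sym neq_w.
have wv : w x != v by rewrite eq_sym neq_w.
have wx : w x != x by rewrite eq_sym neq_w.
have xu : x != u by apply: contraNneq xl => ->.
have xv : x != v by apply: contraNneq vX => <-.
have Nu := leaf_nbE ul vu.
have uG b : b != u -> (u -- b \in G) = (b == v).
  by move=> bu; rewrite -in_set1 -Nu in_nb bu.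
have uP b : (u -- b \in pend w Y) = false by apply: pend_leaf.
have wG b : b != w x -> (w x -- b \in G) = false by apply: notin_supp.
have wP b : b != w x -> (w x -- b \in pend w Y) = false.
  move=> bw; have := pend_iso YX wS bw; rewrite in_setU wG //= => ->.
  apply/negP=> /andP[bY /eqP E].
  by move: xY; rewrite (winj xX (subsetP YX b bY) E) bY.
apply: (F_swap Finv (u := u) (w := w x)).
- move=> b bu bw; rewrite !in_setU !in_set1 in_setD1 !edge_eq uG // uP wG // wP //.
  by edge_simp; rewrite orbC.
- move=> b bu bw; rewrite !in_setU !in_set1 in_setD1 !edge_eq uG // uP wG // wP //.
  by edge_simp; rewrite andNb.
- move=> a b ab au aw bu bw; rewrite !in_setU !in_set1 in_setD1 !edge_eq.
  by edge_simp.
rewrite !in_setU !in_set1 in_setD1 !edge_eq uG // uP.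
by edge_simp.
Qed.

Lemma final_flips u v : u \in leaf G -> v \in nb G u -> v \notin X ->
  (forall x, x \in X -> F (u -- x |: (G :|: pend w (X :\ x)))) ->
  #|I| + 1 + #|hang G X| < k.
Proof.
move=> ul vu vX Fx; have [uS vS vNu vl uvG] := nb_leaf_supp ul vu.
have [F1 F0] := pend_values (subxx X).
have FZ := F0 u v ul vu vX; set Z := _ :|: _ in FZ.
pose S := u |: (I :|: hang G X).
have hS y : y \in hang G X -> y \in supp G.
  by rewrite in_hang => /andP[yl _]; apply: subsetP yl; apply: leaf_supp.
have vS' : v \notin S.
  by rewrite !in_setU in_set1 in_setC in_hang vS (negbTE vl) (negbTE vNu).
have vy y : y \in S -> v != y by apply: contraTneq => <-.
have Fw x : x \in X -> F (w x -- v |: Z).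
  move=> xX; rewrite /Z (pend_delK xX) new_edge_swap ?Fx ?subD1set //.
  by rewrite in_setD1 eqxx.
have uZ : u \notin supp Z by apply: leaf_pend_del.
have flips y : y \in S -> F (y -- v |: Z).
  move=> yS; have vNy := vy y yS; move: (yS).
  rewrite in_setU1 in_setU => /or3P[/eqP->|yI|yh].
  - by rewrite setUA setD1K // F1.
  - have [yw|yw] := boolP (y \in w @: X).
      by have /imsetP[x xX ->] := yw; apply: Fw.
    rewrite (iso_swap Finv (y' := u)) //; first by rewrite setUA setD1K // F1.
    by apply: iso_pend_del; rewrite // in_setD yw.
  move: (yh); rewrite in_hang => /andP[yl pX]; set x := partner G y in pX.
  have Ny : nb G y = [set x] := partner_nb yl.
  have yG b : b != y -> (y -- b \in G) = (b == x).
    by move=> by1; rewrite -in_set1 -Ny in_nb by1.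
  have yP b : (y -- b \in pend w X) = false by apply: pend_leaf.
  have wS := wI pX.
  have wv : v != w x by rewrite neq_w.
  have yu : y != u.
    apply: contraNneq vX => E; move: vu; rewrite -E Ny in_set1 => /eqP-> //.
  have yv : y != v by rewrite eq_sym.
  have xv : x != v by apply: contraNneq vX => <-.
  have wu : w x != u by rewrite eq_sym neq_w.
  rewrite (twin_swap Finv (y' := w x)) ?Fw // => b by1 bw.
  have := pend_iso (subxx X) wS bw; rewrite in_setU (notin_supp wS) //= => Ew.
  rewrite !in_setU !in_setD1 yG // yP orbF (notin_supp wS) // andbF /= Ew.
  edge_simp; apply/eqP/andP => [->|[bX /eqP E]]; first by rewrite eqxx.
  by rewrite (winj pX bX E).
have : #|setX S [set v]| < k.
  apply: (added_flips_lt Fsens (G := Z) (S := S)).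
    by apply: setXS => //; rewrite sub1set in_setC.
  by move=> y z; rewrite in_setX in_set1 /= => /andP[/flips Fy /eqP->]; rewrite Fy FZ.
rewrite cardsX cards1 muln1 cardsU1 cardsU.
have -> : I :&: hang G X = set0.
  apply/setP=> y; rewrite in_setI in_setC in_set0; apply/negP=> /andP[yI /hS].
  exact/negP.
have -> : u \notin I :|: hang G X.
  rewrite in_setU in_setC uS in_hang ul /=.
  have := vu; rewrite partner_nb // in_set1 => /eqP <-; exact: vX.
by rewrite cards0; move: #|I| #|hang G X|; clear; lia.
Qed.

Lemma link_value u v x : x \in X -> u \in leaf G -> v \in nb G u -> v \notin X ->
  k + 2 * #|X| <= 2 * #|I| + 2 ->
  F (u -- x |: (G :|: pend w X)) -> F (w x -- v |: (G :|: pend w X)) ->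
  F (u -- x |: (G :|: pend w (X :\ x))).
Proof.
move=> xX ul vu vX kX Fux Fwv; have [uS vS vNu vl uvG] := nb_leaf_supp ul vu.
apply/negPn/negP=> /negbTE FZ; set Z := _ |: _ in FZ.
pose Y := X :\ x; have YX : Y \subset X by apply: subD1set.
have xS := rich_supp xX; have wS := wI xX; have xl := rich_leaf (subsetP XP x xX).
have xY : x \notin Y by rewrite in_setD1 eqxx.
have xu : x != u by apply: contraNneq xl => ->.
have xv : x != v by apply: contraNneq vX => <-.
have wu : w x != u by rewrite eq_sym neq_w.
have wv : w x != v by rewrite eq_sym neq_w.
have wx : w x != x by rewrite eq_sym neq_w.
pose W := I :\: w @: Y.
have wW : w x \in W.
  rewrite in_setD in_setC wS andbT; apply/imsetP=> -[y yY E].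
  by move: xY; rewrite (winj xX (subsetP YX y yY) E) yY.
have WS y : y \in W -> y \notin supp G by rewrite in_setD in_setC => /andP[].
have neqW y z : y \in W -> z \in supp G -> z != y.
  by move=> /WS yS; apply: contraTneq => ->.
have WZ y : y \in W -> y \notin supp Z.
  move=> yW; rewrite inE negbK -subset0; apply/subsetP=> b.
  rewrite in_nb in_setU1 => /andP[by1].
  rewrite (notin_supp (iso_pend YX yW)) // orbF edge_eq.
  have uy := neqW y u yW uS; have xy := neqW y x yW xS.
  by edge_simp.
have Nu := leaf_nbE ul vu.
have uG b : b != u -> (u -- b \in G) = (b == v).
  by move=> bu; rewrite -in_set1 -Nu in_nb bu.
have uP b : (u -- b \in pend w Y) = false by apply: pend_leaf.
have wG b : b != w x -> (w x -- b \in G) = false by apply: notin_supp.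
have wP b : b != w x -> (w x -- b \in pend w Y) = false.
  move=> bw; have := pend_iso YX wS bw; rewrite in_setU wG //= => ->.
  apply/negP=> /andP[bY /eqP E].
  by move: xY; rewrite (winj xX (subsetP YX b bY) E) bY.
have FZv : F (w x -- v |: Z).
  rewrite (_ : F _ = F (w x -- v |: (G :|: pend w X))) //.
  rewrite (pend_delK xX) -/Y; apply: (F_swap Finv (u := u) (w := w x)).
  - move=> b bu bw; rewrite !in_setU !in_set1 !edge_eq uG // uP wG // wP //.
    by edge_simp.
  - move=> b bu bw; rewrite !in_setU !in_set1 !edge_eq uG // uP wG // wP //.
    by edge_simp; rewrite orbC.
  - move=> a b ab au aw bu bw; rewrite !in_setU !in_set1 !edge_eq.
    by edge_simp.
  rewrite !in_setU !in_set1 !edge_eq uG // uP.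
  by edge_simp.
have : #|setX W [set x; v]| < k.
  apply: (added_flips_lt Fsens (G := Z) (S := I)).
    apply: setXS; first exact: subsetDl.
    by rewrite subUset !sub1set !in_setC !negbK xS.
  move=> y z; rewrite in_setX in_set2 /= => /andP[yW /orP[]/eqP->]; rewrite FZ.
    rewrite (iso_swap Finv (WZ y yW) (WZ _ wW)) ?neqW //.
    by rewrite /Z setUCA (setUCA _ G) -(pend_delK xX) Fux.
  by rewrite (iso_swap Finv (WZ y yW) (WZ _ wW)) ?neqW // FZv.
rewrite cardsX cards2 xv card_iso_w //.
have := cardsD1 x X; rewrite xX -/Y add1n; move: kX.
by move: #|X| #|Y| #|I|; clear; lia.
Qed.

Lemma good_parent : k + #|hang G X| <= 2 * #|rich_parents G :\: X| + #|G| ->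
  exists2 v, v \in rich_parents G :\: X &
  forall x u, x \in X -> u \in leaves G v ->
    F (u -- x |: (G :|: pend w X)) /\ F (w x -- v |: (G :|: pend w X)).
Proof.
move=> kV; set V := _ :\: X in kV *; set Z := G :|: _.
have [FZ F0] := pend_values (subxx X).
pose ok x u v := F (u -- x |: Z) && F (w x -- v |: Z).
have [/exists_inP[v vV /forall_inP good]|] :=
  boolP [exists v in V, [forall x in X, [forall u in leaves G v, ok x u v]]].
  exists v => // x u xX uv; have /forall_inP/(_ u uv)/andP[] := good x xX.
  by split.
rewrite negb_exists_in => /forall_inP bad.
pose S := I :|: leaf G.
pose P := [set p in setX S (~: S) | ~~ F (p.1 -- p.2 |: Z)].
have flips : #|G :\: hang_edges X| + #|P| < k.
  apply: (flips_lt Fsens (G := Z) (S := S)).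
  - by move=> e; rewrite in_setD => /andP[_ /(minimal_edge Finv minG)].
  - by move=> e /(del_flips (subxx X) F0)->; rewrite FZ.
  - by apply/subsetP=> p; rewrite in_set => /andP[].
  by move=> y z; rewrite in_set /= => /andP[_ /negbTE->]; rewrite FZ.
pose q (p : T * T) := if p.2 \in X then partner G p.1 else p.2.
have fib v : v \in V -> 2 <= #|[set p in P | q p == v]|.
  rewrite in_setD => /andP[vX vR].
  have v2 : 1 < #|leaves G v| by move: vR; rewrite in_set.
  have vl := rich_leaf vR.
  have vS : v \in supp G.
    rewrite inE -card_gt0.
    by apply: leq_trans (subset_leq_card (subsetIl _ _)); apply: leq_trans v2.
  have := bad v; rewrite in_setD vX vR negb_forall_in => /(_ isT)/exists_inP[x xX].
  rewrite negb_forall_in => /exists_inP[u uv]; rewrite negb_and => Fuv.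
  have xS := rich_supp xX; have xl := rich_leaf (subsetP XP x xX).
  have wS := wI xX.
  case/orP: Fuv => Fuv.
    rewrite -(card_imset (leaves G v) (f := fun u => (u, x))) in v2; last by move=> ? ? [].
    apply: leq_trans v2 _; apply/subset_leq_card/subsetP=> p /imsetP[u' u'v ->].
    move: (u'v); rewrite in_leaves => /andP[u'l /eqP pu'].
    move: (uv); rewrite in_leaves => /andP[ul /eqP pu].
    rewrite in_set /q /= xX pu' eqxx andbT in_set in_setX /= /S /I !(in_setC, in_setU).
    rewrite u'l orbT (negbTE xl) xS /=.
    rewrite (twin_swap Finv (y' := u)) //.
    - move=> b bu' bu; rewrite !in_setU !pend_leaf // !orbF.
      have := in_nb G u' b; rewrite partner_nb // pu' bu' /= => <-.
      by have := in_nb G u b; rewrite partner_nb // pu bu /= => <-.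
    - by apply: contraNneq xl => ->.
    - by apply: contraNneq xl => ->.
  have x2 : 1 < #|leaves G x| by have := subsetP XP x xX; rewrite in_set.
  rewrite -(card_imset (leaves G x) (f := fun u => (u, v))) in x2; last by move=> ? ? [].
  apply: leq_trans x2 _; apply/subset_leq_card/subsetP=> p /imsetP[y yx ->].
  move: (yx); rewrite in_leaves => /andP[yl /eqP py].
  rewrite in_set /q /= (negbTE vX) eqxx andbT in_set in_setX /= /S /I !(in_setC, in_setU).
  rewrite yl orbT (negbTE vl) vS /=.
  rewrite (twin_swap Finv (y' := w x)) //.
  - move=> b by1 bw; rewrite (pend_iso (subxx X) wS bw) in_setU pend_leaf // orbF.
    have := in_nb G y b; rewrite partner_nb // py by1 /= => <-; rewrite in_set1.
    apply/eqP/andP => [->|[bX /eqP E]]; first by rewrite eqxx.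
    by rewrite (winj xX bX E).
  - by apply: contraNneq vl => ->.
  - by rewrite neq_w.
have : 2 * #|V| <= #|P|.
  apply: (@leq_trans (\sum_(v in V) #|[set p in P | q p == v]|)).
    by rewrite mulnC -sum_nat_const leq_sum.
  apply: (@leq_trans #|[set p in P | q p \in V]|); last first.
    by apply/subset_leq_card/subsetP=> p; rewrite in_set => /andP[].
  rewrite -[X in _ <= X]sum1_card (partition_big q (mem V)) /=; last first.
    by move=> p; rewrite in_set => /andP[].
  apply: leq_sum => v vV; rewrite -sum1_card; apply/eq_leq/eq_bigl => p.
  rewrite [LHS]in_set [X in _ = X && _]in_set -andbA; congr (_ && _).
  by case: eqP => [->|]; rewrite ?vV ?andbF.
move: (card_hang_edges X) flips kV.
by move: #|hang G X| #|G :\: _| #|P| #|V| #|G|; clear; lia.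
Qed.

End Pendants.

Section Conclusion.

Variables (T : finType) (F : {set {set T}} -> bool) (k : nat).
Hypotheses (Finv : invariant F) (Fsens : low_sens F k) (kT : 2 * k <= #|T|).
Hypothesis k600 : 600 <= k.
Implicit Types (a b u v x y z : T) (e : {set T}) (X Y : {set T}).

Lemma injection_exists (X Y : {set T}) : #|X| <= #|Y| ->
  exists w : T -> T, (forall x, x \in X -> w x \in Y) /\ {in X &, injective w}.
Proof.
move=> XY; pose w x := nth x (enum Y) (index x (enum X)).
have lt x : x \in X -> index x (enum X) < size (enum Y).
  by move=> xX; rewrite -cardE (leq_trans _ XY) // cardE index_mem mem_enum.
exists w; split=> [x xX|x y xX yX]; first by rewrite -mem_enum mem_nth ?lt.
rewrite /w (set_nth_default y) ?lt // => /eqP.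
rewrite nth_uniq ?enum_uniq ?lt // => /eqP E.
by rewrite -(nth_index y (s := enum X) (x := x)) ?E ?nth_index ?mem_enum.
Qed.

Lemma minimal_leafless G : minset F G -> leaf G = set0.
Proof.
move=> minG0; apply/eqP/negPn/negP=> leafG0.
pose P K := minset F K && (leaf K != set0).
have PG0 : P G by rewrite /P minG0.
have [{minG0 leafG0 PG0}G /andP[minG leafG] innerG0] :=
  arg_minnP (fun K => #|inner K|) PG0.
have innerG K : minset F K -> leaf K != set0 -> #|inner G| <= #|inner K|.
  by move=> minK leafK; apply: innerG0; rewrite /P minK.
have /set0Pn[u0 u0l] := leafG.
set R := rich_parents G; set I := ~: supp G.
have i1 := minimal_leaf_iso Finv Fsens minG u0l; rewrite -/I in i1.
have cI := cardsC (supp G); rewrite -/I in cI.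
have cm := minimal_card Finv Fsens minG.
have c43 := card_supp_43 Finv Fsens kT k600 minG.
have cR := card_rich_parents Finv Fsens kT k600 minG; rewrite -/R in cR.
have cH Y : Y \subset R -> 2 * #|Y| <= #|hang G Y|.
  move=> YR; rewrite card_hang mulnC -sum_nat_const leq_sum // => x /(subsetP YR).
  by rewrite in_set.
have hangD1 x Y : x \in Y -> #|hang G Y| = #|leaves G x| + #|hang G (Y :\ x)|.
  by move=> xY; rewrite !card_hang (big_setD1 x).
pose Q Y := (Y \subset R) && (k <= #|hang G Y| + 1 + #|I|).
have QR : Q R.
  rewrite /Q subxx /=; move: (cH R (subxx R)) cI cm c43 cR kT i1.
  by move: #|hang G R| #|R| #|I| #|supp G| #|G| #|T|; clear; lia.
have [X minX _] := minset_exists QR.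
have [/andP[XR kX] Xmin] := minsetP minX.
have hX x : x \in X -> #|hang G (X :\ x)| + 1 + #|I| < k.
  move=> xX; rewrite ltnNge; apply/negP=> k'.
  have /Xmin : Q (X :\ x) by rewrite /Q k' (subset_trans (subD1set _ _)).
  move=> /(_ (subD1set _ _)) E; have := setD11 x X.
  by rewrite E xX.
have [x1 x1X] : exists x, x \in X.
  apply/set0Pn; apply: contraTneq kX => ->.
  by rewrite -ltnNge card_hang big_set0; move: i1; move: #|I|; clear; lia.
have [x xX xmin] := arg_minnP (fun x => #|leaves G x|) x1X.
have {}xX : x \in X := xX.
have x2 : 2 <= #|leaves G x| by have := subsetP XR x xX; rewrite in_set.
have cX := cardsD1 x X; rewrite xX add1n in cX.
have hXx := hX x xX.
have lX : #|X :\ x| * #|leaves G x| <= #|hang G (X :\ x)|.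
  rewrite card_hang -sum_nat_const leq_sum // => y; rewrite in_setD1 => /andP[_].
  exact: xmin.
have c2 := cH (X :\ x) (subset_trans (subD1set _ _) XR).
have hXE := hangD1 x X xX.
have [w [wI winj]] : exists w : T -> T,
    (forall x, x \in X -> w x \in I) /\ {in X &, injective w}.
  apply: injection_exists; move: hXx c2 cX cI cm c43 kT i1.
  by move: #|X| #|X :\ x| #|hang G (X :\ x)| #|I| #|supp G| #|G| #|T|; clear; lia.
have {}wI y : y \in X -> w y \notin supp G by move=> /wI; rewrite in_setC.
have proper_le Y : Y \proper X ->
    #|Y| <= #|X :\ x| /\ #|hang G Y| + 1 + #|I| < k.
  move=> YX; split.
    by rewrite -ltnS -cX; apply: proper_card.
  have [sYX [y yX yY]] := properP YX; apply: leq_ltn_trans (hX y yX).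
  rewrite !leq_add2r; apply/subset_leq_card/hangS/subsetP=> z zY.
  by rewrite in_setD1 (subsetP sYX) // andbT; apply: contraNneq yY => <-.
have budget1 Y : Y \proper X -> k + #|Y| + #|hang G Y| <= #|I| + #|G|.
  move=> /proper_le[]; move: hXx c2 cX cI cm c43 kT i1.
  move: #|Y| #|hang G Y| #|X| #|X :\ x| #|hang G (X :\ x)| #|I| #|supp G| #|G| #|T|.
  by clear; lia.
have budget2 Y : Y \proper X -> k + 2 * #|Y| <= 2 * #|I| + 2.
  move=> /proper_le[+ _]; move: hXx c2 cX cI cm c43 kT i1.
  move: #|Y| #|X| #|X :\ x| #|hang G (X :\ x)| #|I| #|supp G| #|G| #|T|.
  by clear; lia.
have fin := final_flips Finv Fsens kT k600 minG innerG XR wI winj budget1 budget2.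
have finE u v : u \in leaves G v -> v \in R :\: X ->
    (forall x, x \in X -> F (u -- x |: (G :|: pend w (X :\ x)))) -> False.
  rewrite in_setI nbC => /andP[vu ul]; rewrite in_setD => /andP[vX _] Fx.
  have := fin u v ul vu vX Fx; rewrite -/I; move: kX.
  by move: #|hang G X| #|I|; clear; lia.
have pick_leaf v : v \in R -> exists u, u \in leaves G v.
  by rewrite in_set => v2; apply/set0Pn; rewrite -card_gt0 ltnW.
have cRX : #|R :\: X| = #|R| - #|X| by rewrite cardsD (setIidPr XR).
have [X1|X2] := leqP #|X| 1.
  have X1E : X = [set x].
    by apply/esym/eqP; rewrite eqEcard sub1set xX cards1.
  have D0 : X :\ x = set0 by rewrite X1E setDv.
  have xS : x \in supp G by apply: (rich_supp XR).
  have xl : x \notin leaf G.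
    exact: (rich_leaf Finv Fsens kT k600 minG (subsetP XR x xX)).
  have : #|G| + #|setX (hang G (R :\: X)) [set x]| < k.
    apply: (flips_lt Fsens (G := G) (S := leaf G)).
    - exact: (minimal_edge Finv minG).
    - by move=> e eG; rewrite (minimal_true minG) (minimal_del minG).
    - apply: setXS; last by rewrite sub1set in_setC.
      by apply/subsetP=> u; rewrite in_hang => /andP[].
    move=> u z; rewrite in_setX in_set1 /= => /andP[+ /eqP->].
    rewrite in_hang (minimal_true minG) => /andP[ul pV]; apply/negP=> /eqP Fux.
    apply: (finE u (partner G u)) => //; first by rewrite in_leaves ul /=.
    by move=> y; rewrite X1E in_set1 => /eqP->; rewrite setDv /pend imset0 setU0.
  rewrite cardsX cards1 muln1.
  have := cH (R :\: X) (subsetDl _ _); rewrite cRX.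
  move: X1 cR cI cm c43 kT i1.
  move: #|hang G _| #|R| #|X| #|I| #|supp G| #|G| #|T|.
  by clear; lia.
have [|v vV good] := good_parent Finv Fsens kT k600 minG innerG XR wI winj budget1 budget2.
  rewrite -/R cRX.
  move: X2 cR cI cm c43 kT i1 hXE hXx lX x2 cX.
  move: #|hang G X| #|hang G (X :\ x)| #|leaves G x| #|R| #|X| #|X :\ x| #|I| #|supp G| #|G| #|T|.
  clear=> h h' l r j j' i t m n; nia.
have [vX vR] : v \notin X /\ v \in R by apply/andP; rewrite -in_setD.
have [u uv] := pick_leaf v vR.
apply: (finE u v uv vV) => y yX; have [F1 F2] := good y u yX uv.
have := uv; rewrite in_setI nbC => /andP[vu ul].
apply: (link_value Finv Fsens kT k600 minG XR wI winj yX ul vu vX _ F1 F2).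
move: hXx c2 cX cI cm c43 kT i1.
by move: #|X| #|X :\ x| #|hang G (X :\ x)| #|I| #|supp G| #|G| #|T|; clear; lia.
Qed.

Lemma property_trivial : F set0 = false -> forall G, F G = false.
Proof.
move=> F0 G; apply/negP=> FG.
have [K minK _] := minset_exists FG.
have degK G' x : minset F G' -> x \in supp G' -> 1 < #|nb G' x|.
  move=> minG' xG'; have := in_set0 x; rewrite -(minimal_leafless minG') inE.
  by move: xG'; rewrite inE -card_gt0; case: #|nb G' x| => [|[]].
pose P (p : {set {set T}} * T) := minset F p.1 && (p.2 \in supp p.1).
have [x xK] : exists x, x \in supp K.
  have /set0Pn[e eK] : K != set0.
    by apply: contraTneq (minimal_true minK) => ->; rewrite F0.
  have [a [b [ab Ee]]] := minimal_edgeP Finv minK eK.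
  by exists a; rewrite (in_supp ab) -?Ee.
have PK : P (K, x) by rewrite /P minK.
have [[G' u] /andP[/= minG' uG'] umin] := arg_minnP (fun p => #|nb p.1 p.2|) PK.
have := degK G' u minG' uG'; rewrite ltnNge => /negP; apply.
apply: (minimal_degree_le1 Finv Fsens kT minG' uG') => H y minH yH.
by apply: (umin (H, y)); rewrite /P minH.
Qed.

End Conclusion.

Section FromGraphs.

Variables (n : nat) (f : graph n -> bool).
Implicit Types (G : {set {set 'I_n}}) (e : vpair n).

Definition edge_graph G : graph n := [ffun e => val e \in G].

Definition edge_property G := f (edge_graph G) (+) f (edge_graph set0).

Lemma edge_graph_surj (x : graph n) : edge_graph [set val e | e : vpair n & x e] = x.
Proof.
apply/ffunP=> e; rewrite ffunE; apply/imsetP/idP => [[e' + /val_inj->]|xe].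
  by rewrite inE.
by exists e; rewrite ?inE.
Qed.

Lemma flip_edge_graph G e : flip (edge_graph G) e =
  edge_graph (if val e \in G then G :\ val e else val e |: G).
Proof.
apply/ffunP=> e'; rewrite !ffunE.
have [->|ne] := eqVneq e' e; case: ifP => eG;
  by rewrite ?eG ?in_setD1 ?in_setU1 (inj_eq val_inj) ?eqxx ?(negbTE ne).
Qed.

Lemma edge_property_invariant : graph_property f -> invariant edge_property.
Proof.
move=> fP s G G' E; congr (_ (+) _); apply: fP; exists s => e; rewrite !ffunE /=.
have /cards2P[a [b [ab ->]]] := valP e.
by rewrite imsetU !imset_set1 E.
Qed.

Lemma edge_property_low_sens k :
  sensitivity f < k -> low_sens edge_property k.
Proof.
move=> fk G D D2 DF; apply: leq_ltn_trans fk.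
apply: leq_trans (leq_bigmax (edge_graph G)).
have -> : D = val @: [set e : vpair n | val e \in D].
  apply/setP=> e; apply/idP/imsetP => [eD|[e' + ->]]; last by rewrite inE.
  have e2 : #|e| == 2 by rewrite D2.
  by exists (exist _ e e2); rewrite ?inE.
rewrite card_imset; last exact: val_inj.
apply/subset_leq_card/subsetP=> e; rewrite !inE => eD; have := DF _ eD.
rewrite flip_edge_graph /edge_property !(inj_eq (@addIb _)).
case: ifP => eG; last by rewrite setD1_notin ?eG ?eqxx.
by rewrite (setUidPr _) ?sub1set ?eG // eqxx orbF.
Qed.

End FromGraphs.

Theorem theorem1p2 :
  exists N : nat, forall n : nat, N <= n ->
    forall f : graph n -> bool,
      graph_property f -> nontrivial f ->
      n./2 <= sensitivity f.
Proof.
exists 1200 => n nN f fP [x [y]]; rewrite leqNgt; apply: contra => fk.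
have Finv := edge_property_invariant fP.
have Fsens := edge_property_low_sens fk.
have k600 : 600 <= n./2 by rewrite (half_leq nN).
have kT : 2 * n./2 <= #|'I_n| by rewrite card_ord mul2n -[X in _ <= X]odd_double_half leq_addl.
have F0 : edge_property f set0 = false by apply: addbb.
have const z : f z = f (edge_graph set0).
  have := property_trivial Finv Fsens kT k600 F0 [set val e | e : vpair n & z e].
  by rewrite /edge_property edge_graph_surj => /negbT; rewrite -negb_eqb negbK => /eqP.
by rewrite !const.
Qed.
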